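(* For an oriented virtual link diagram $K$, the normalized bracket $A^{-8wr(K)}[[K]]\in\mathcal M$ is invariant under all (generalized) Reidemeister moves and under the virtualization move, where $wr(K)$ is the sum of the signs of all classical crossings of $K$.
   Context: **Graphs.** $\mathcal S$ is the collection of all finite trivalent bipartite graphs (abstract graphs, multiple edges allowed, up to isomorphism) with every edge oriented from the first part to the second part. Circles (closed components with no vertices) are also allowed as components. A bigon is a pair of distinct edges joining the same two vertices; a quadrilateral is a $4$-cycle with four distinct vertices. $\mathcal T=\{t_1,t_2,\dots\}\subset\mathcal S$ is the set of connected graphs having neither bigons nor quadrilaterals. $\mathcal M=\mathbb Z[A,A^{-1}][t_1,t_2,\dots]$ consists of formal commutative products of graphs from $\mathcal T$ with Laurent polynomial coefficients. **The map $f$.** $f$ is the unique map from finite disjoint unions of graphs of $\mathcal S$ and circles to $\mathcal M$ that sends disjoint unions to products, satisfies $f(t)=t$ for $t\in\mathcal T$, $f(\bigcirc)=A^6+1+A^{-6}$, $f(\Gamma)=(A^3+A^{-3})f(\Gamma')$ when $\Gamma'$ is obtained by resolving a bigon of $\Gamma$ (delete its two vertices and two edges and join the two remaining half-edges), and $f(\Gamma)=f(\Gamma_1)+f(\Gamma_2)$ for a quadrilateral $v_1v_2v_3v_4$ of $\Gamma$ with outer half-edges $l_i$ at $v_i$, where the quadrilateral's vertices and edges are deleted and one joins $l_1$ to $l_2$ and $l_3$ to $l_4$ (for $\Gamma_1$), or $l_2$ to $l_3$ and $l_4$ to $l_1$ (for $\Gamma_2$). Closed curves produced are circles. **Bracket.**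 At a classical crossing with sign $\epsilon=\pm1$, incoming edges $a,b$ and outgoing edges $c,d$, where $a$ continues to $c$ and $b$ to $d$, there are two local states: the oriented one (join $a$ to $d$ and $b$ to $c$), of weight $A^{2\epsilon}$; and the unoriented one (replace the crossing by a sink vertex receiving $a,b$, a source vertex emitting $c,d$, and a new edge from the source to the sink), of weight $-A^{-\epsilon}$. A state $s$ is a choice of local state at each classical crossing; $K_s$ is the resulting abstract graph (virtual crossings are ignored), possibly with circles; $w(s)$ is the product of the weights of the chosen local states. $[[K]]=\sum_s w(s)f(K_s)$. **Moves.** Generalized Reidemeister moves on virtual diagrams are the classical Reidemeister moves together with the detour moves (equivalently, virtual Reidemeister moves). The virtualization move replaces a classical crossing by the same crossing flanked by two virtual crossings; in terms of Gauss diagrams it reverses the direction (over/under) of one arrow and keeps its sign. *)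

(* Defs.v *)
From HB Require Import structures.
From Stdlib Require Export Relation_Operators.
From mathcomp Require Export all_boot all_order all_fingroup all_algebra.
From mathcomp Require Export generic_quotient ring_quotient finmap.
From mathcomp.multinomials Require Export monalg.

Set Implicit Arguments.
Unset Strict Implicit.
Unset Printing Implicit Defensive.

Import GRing.Theory.
Local Open Scope ring_scope.
Local Open Scope quotient_scope.

(* Z[A, A^-1] is realised as Z[A][B] modulo the kernel of the evaluation      *)
(* B |-> A^-1 into Q(A).                                                      *)

Definition eval_inverse : {poly {poly int}} -> {fraction {poly int}} :=
  fun p => (map_poly (@tofrac {poly int}) p).[(tofrac 'X)^-1].

Definition laurent_ideal (p : {poly {poly int}}) : bool := eval_inverse p == 0.

Fact mem_laurent_ideal p : (p \in laurent_ideal) = (eval_inverse p == 0).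
Proof. by []. Qed.

Fact laurent_ideal_closed : idealr_closed laurent_ideal.
Proof.
split; rewrite ?mem_laurent_ideal /eval_inverse ?rmorph0 ?horner0 //.
  by rewrite rmorph1 hornerC oner_eq0.
move=> a p q; rewrite !mem_laurent_ideal /eval_inverse => /eqP p0 /eqP q0.
by rewrite rmorphD rmorphM hornerD hornerM p0 q0 mulr0 addr0.
Qed.

HB.instance Definition _ :=
  isIdealr.Build {poly {poly int}} laurent_ideal laurent_ideal_closed.

Definition laurent_idealr : idealr {poly {poly int}} :=
  [the idealr {poly {poly int}} of laurent_ideal].

Definition laurent : comNzRingType := {ideal_quot laurent_idealr}.

Definition varA : laurent := \pi_({ideal_quot laurent_idealr}) ('X%:P).
Definition varAinv : laurent := \pi_({ideal_quot laurent_idealr}) 'X.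

Fact varA_inv : varA * varAinv = 1.
Proof.
rewrite /varA /varAinv -rmorphM -(rmorph1 \pi_({ideal_quot laurent_idealr})).
apply/eqP; rewrite -Quotient.idealrBE mem_laurent_ideal /eval_inverse.
rewrite rmorphB rmorphM rmorph1 /= map_polyC map_polyX /=.
by rewrite !hornerE mulfV ?subrr // tofrac_eq0 polyX_eq0.
Qed.

Definition Apow (z : int) : laurent :=
  match z with Posz n => varA ^+ n | Negz n => varAinv ^+ n.+1 end.

(* A graph is considered up to homeomorphism: bivalent vertices are allowed  *)
(* and count as interior points of edges, so that a circle without vertices  *)
(* is presented by any directed cycle of bivalent vertices, and joining two  *)
(* half-edges just creates a bivalent vertex.  The first part of the         *)
(* bipartition is the set of sources, the second one is the set of sinks.    *)

Record digraph := Digraph {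
  node : finType;
  arc : finType;
  src : arc -> node;
  tgt : arc -> node }.

Section Digraph.
Variable G : digraph.

Definition indeg (v : node G) := #|[set a : arc G | tgt a == v]|.
Definition outdeg (v : node G) := #|[set a : arc G | src a == v]|.

Definition trivalent (v : node G) :=
  ((indeg v, outdeg v) == (0, 3)%N) || ((indeg v, outdeg v) == (3, 0)%N).

Definition bivalent (v : node G) := (indeg v, outdeg v) == (1, 1)%N.

Definition web := [forall v : node G, trivalent v || bivalent v].

Definition connected :=
  n_comp [rel u v : node G | [exists a : arc G,
    [set src a; tgt a] == [set u; v]]] predT == 1%N.

Definition is_bigon (a b : arc G) :=
  [&& a != b, src a == src b & tgt a == tgt b].

(* The 4-cycle v1 -a- v2 -b- v3 -c- v4 -d- v1, labelled so that v1 and v3 are *)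
(* the sources and v2 and v4 the sinks.                                      *)
Definition is_quad (a b c d : arc G) :=
  [&& tgt a == tgt b, src b == src c, tgt c == tgt d, src d == src a,
      src a != src b & tgt a != tgt c].

Definition prime_graph :=
  [&& connected, [forall v : node G, trivalent v],
      ~~ [exists a : arc G, exists b : arc G, is_bigon a b] &
      ~~ [exists a : arc G, exists b : arc G, exists c : arc G,
          exists d : arc G, is_quad a b c d]].

(* Deletes the arcs in D and reverses the arcs in S.  When an arc from v to  *)
(* w is reversed and one further arc is deleted at v and at w, both become   *)
(* bivalent, and the half-edge entering w is joined to the one leaving v.    *)
Definition splice (D S : {set arc G}) : digraph :=
  @Digraph (node G) {a : arc G | a \notin D}
    (fun a => if val a \in S then tgt (val a) else src (val a))
    (fun a => if val a \in S then src (val a) else tgt (val a)).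

Definition subdivide (e : arc G) : digraph :=
  @Digraph (option (node G)) (option (arc G))
    (fun a => omap (@src G) a)
    (fun a => if a is Some b then if b == e then None else Some (tgt b)
              else Some (tgt e)).

End Digraph.

Definition digraph_iso (G H : digraph) : bool :=
  [exists h : {ffun node G -> node H}, exists k : {ffun arc G -> arc H},
    [&& injectiveb h, injectiveb k,
        #|node G| == #|node H|, #|arc G| == #|arc H| &
        [forall a, (src (k a) == h (src a)) && (tgt (k a) == h (tgt a))]]].

Definition disjoint_union (G H : digraph) : digraph :=
  @Digraph (node G + node H)%type (arc G + arc H)%type
    (fun a => match a with inl b => inl (src b) | inr b => inr (src b) end)
    (fun a => match a with inl b => inl (tgt b) | inr b => inr (tgt b) end).

Definition circle : digraph := @Digraph unit unit id id.

(* Every finite digraph is isomorphic to one on ordinals; the isomorphism    *)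
(* classes of the latter index the polynomial variables.                     *)

Definition coded_digraph :=
  {n : nat & {m : nat & {ffun 'I_m -> 'I_n * 'I_n}}}.

Definition decode (c : coded_digraph) : digraph :=
  @Digraph 'I_(tag c) 'I_(tag (tagged c))
    (fun a => (tagged (tagged c) a).1) (fun a => (tagged (tagged c) a).2).

Definition prime_code := {c : coded_digraph | prime_graph (decode c)}.

Definition prime_iso (s t : prime_code) :=
  digraph_iso (decode (val s)) (decode (val t)).

Fact digraph_iso_refl G : digraph_iso G G.
Proof.
apply/existsP; exists [ffun x => x]; apply/existsP; exists [ffun x => x].
rewrite !eqxx /=; apply/and3P; split.
- by apply/injectiveP => x y; rewrite !ffunE.
- by apply/injectiveP => x y; rewrite !ffunE.
- by apply/forallP => a; rewrite !ffunE !eqxx.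
Qed.

Fact digraph_iso_sym G H : digraph_iso G H -> digraph_iso H G.
Proof.
case/existsP => h /existsP[k] /and5P[/injectiveP hI /injectiveP kI].
move=> /eqP eN /eqP eA /forallP E.
have [h' hK h'K] : bijective h by apply: inj_card_bij hI _; rewrite eN.
have [k' kK k'K] : bijective k by apply: inj_card_bij kI _; rewrite eA.
apply/existsP; exists [ffun x => h' x]; apply/existsP; exists [ffun x => k' x].
rewrite eN eA !eqxx /=; apply/and3P; split.
- by apply/injectiveP => x y; rewrite !ffunE => /(can_inj h'K).
- by apply/injectiveP => x y; rewrite !ffunE => /(can_inj k'K).
- apply/forallP => a; rewrite !ffunE; have /andP[/eqP Es /eqP Et] := E (k' a).
  by rewrite k'K in Es Et; rewrite Es Et !hK !eqxx.
Qed.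

Fact digraph_iso_trans G H L :
  digraph_iso G H -> digraph_iso H L -> digraph_iso G L.
Proof.
case/existsP => h /existsP[k] /and5P[/injectiveP hI /injectiveP kI].
move=> /eqP eN /eqP eA /forallP E.
case/existsP => h' /existsP[k'] /and5P[/injectiveP hI' /injectiveP kI'].
move=> /eqP eN' /eqP eA' /forallP E'.
apply/existsP; exists [ffun x => h' (h x)].
apply/existsP; exists [ffun x => k' (k x)].
rewrite eN eA eN' eA' !eqxx /=; apply/and3P; split.
- by apply/injectiveP => x y; rewrite !ffunE => /hI' /hI.
- by apply/injectiveP => x y; rewrite !ffunE => /kI' /kI.
- apply/forallP => a; rewrite !ffunE.
  have /andP[/eqP -> /eqP ->] := E' (k a).
  by have /andP[/eqP -> /eqP ->] := E a; rewrite !eqxx.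
Qed.

Fact prime_iso_refl : reflexive prime_iso.
Proof. by move=> s; apply: digraph_iso_refl. Qed.

Fact prime_iso_sym : symmetric prime_iso.
Proof. by move=> s t; apply/idP/idP; apply: digraph_iso_sym. Qed.

Fact prime_iso_trans : transitive prime_iso.
Proof. by move=> t s u; apply: digraph_iso_trans. Qed.

Canonical prime_iso_equiv :=
  EquivRel prime_iso prime_iso_refl prime_iso_sym prime_iso_trans.

Definition prime_class := {eq_quot prime_iso}.

Definition graph_poly := {malg laurent[{cmonom prime_class}]}.

Definition graph_var (t : prime_class) : graph_poly := << ucm t >>.

(* The clauses constrain f on webs only, and determine it there, since they  *)
(* reduce every web to a product of prime graphs.  The empty product is      *)
(* covered by eval_union, as f circle is not a zero divisor.                 *)
Record graph_evaluation (f : digraph -> graph_poly) : Prop := GraphEvaluation {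
  eval_iso : forall G H, web G -> web H -> digraph_iso G H -> f G = f H;
  eval_subdivide : forall G (e : arc G), web G -> f (subdivide e) = f G;
  eval_union : forall G H, web G -> web H ->
    f (disjoint_union G H) = f G * f H;
  eval_prime : forall t : prime_code,
    f (decode (val t)) = graph_var (\pi_prime_class t);
  eval_circle : f circle = (Apow 6 + 1 + Apow (- 6))%:MP;
  eval_bigon : forall G (a b : arc G), web G -> is_bigon a b ->
    f G = (Apow 3 + Apow (- 3))%:MP * f (splice [set b] [set a]);
  eval_quad : forall G (a b c d : arc G), web G -> is_quad a b c d ->
    f G = f (splice [set b; d] [set a; c]) + f (splice [set a; c] [set b; d]) }.

(* A diagram is a union of oriented closed curves with marked points,        *)
(* succ p being the point after p; strand (x, i) is the marked point where   *)
(* the strand number i of the crossing x passes through it.  The strands of  *)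
(* x are numbered so that strand true crosses strand false from its right to *)
(* its left.  A marked point that is not on a crossing has no meaning of its *)
(* own; such points present crossing-free components.  kind is None for a    *)
(* virtual crossing and Some e for a classical one, e = true meaning that    *)
(* the sign is +1; strand false is the overcrossing one iff the sign is +1.  *)

Record diagram := Diagram {
  point : finType;
  succ : point -> point;
  crossing : finType;
  kind : crossing -> option bool;
  strand : crossing * bool -> point }.

Section Diagram.
Variable K : diagram.

Definition crossing_at (p : point K) : option (crossing K * bool) :=
  [pick v | strand v == p].

(* A dart (p, o) is the outgoing (o = true) or incoming half-edge at p; rot  *)
(* is the counterclockwise rotation of the half-edges around a vertex of the *)
(* underlying plane graph.                                                   *)
Definition dart := (point K * bool)%type.

Definition rot (d : dart) : dart :=
  match crossing_at d.1 with
  | Some (x, i) => (strand (x, ~~ i), if i then ~~ d.2 else d.2)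
  | None => (d.1, ~~ d.2)
  end.

Definition edge (d : dart) : dart :=
  if d.2 then (succ d.1, false) else (finv (@succ K) d.1, true).

Definition face (d : dart) : dart := rot (edge d).

Definition dart_link : rel dart :=
  [rel d d' | (rot d == d') || (edge d == d')].

(* Euler's formula, vertices + faces = edges + 2 * components, for the plane *)
(* graph whose vertices are the crossings and the remaining marked points.   *)
(* The position of the connected components of a plane diagram relative to   *)
(* each other is not recorded.                                               *)
Definition planar :=
  (fcard rot predT + fcard face predT ==
     fcard edge predT + 2 * n_comp dart_link predT)%N.

Definition well_formed : Prop :=
  [/\ injective (@succ K), injective (@strand K) & planar].

Definition classical : {set crossing K} := [set x | kind x != None].

Definition sign (x : crossing K) : int :=
  match kind x with Some true => 1 | Some false => -1 | None => 0 end.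

Definition writhe : int := \sum_x sign x.

(* A state is given by the set U of its crossings with the unoriented local  *)
(* state.  The arc of K leaving the point p is inl p.  At a crossing with    *)
(* the oriented state the two outgoing arcs are exchanged; at a crossing x   *)
(* of U the point strand (x, false) becomes the sink, the point              *)
(* strand (x, true) the source, and the new arc is inr x.                    *)
Section State.
Variable U : {set crossing K}.

Definition out_end (p : point K) : point K :=
  match crossing_at p with
  | Some (x, i) => if x \in U then strand (x, true)
                   else if x \in classical then strand (x, ~~ i) else p
  | None => p
  end.

Definition in_end (p : point K) : point K :=
  match crossing_at p with
  | Some (x, _) => if x \in U then strand (x, false) else p
  | None => p
  end.

Definition state_graph : digraph :=
  @Digraph (point K) (point K + {x : crossing K | x \in U})%type
    (fun a => match a with
              | inl p => out_end p
              | inr x => strand (val x, true)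
              end)
    (fun a => match a with
              | inl p => in_end (succ p)
              | inr x => strand (val x, false)
              end).

Definition state_weight : laurent :=
  \prod_(x in classical)
    if x \in U then - Apow (- sign x) else Apow (2 * sign x).

End State.

Variable f : digraph -> graph_poly.

Definition bracket : graph_poly :=
  \sum_(U : {set crossing K} | U \subset classical)
    (state_weight U)%:MP * f (state_graph U).

Definition normalized_bracket : graph_poly :=
  (Apow (- 8 * writhe))%:MP * bracket.

(* The crossings in D disappear, both strands going straight on.             *)
Definition erase (D : {set crossing K}) : diagram :=
  @Diagram (point K) (@succ K) {x : crossing K | x \notin D}
    (fun x => kind (val x)) (fun v => strand (val v.1, v.2)).

Definition restrand (h : crossing K * bool -> point K) : diagram :=
  @Diagram (point K) (@succ K) (crossing K) (@kind K) h.

Definition add_point (p : point K) : diagram :=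
  @Diagram (option (point K))
    (fun q => if q is Some r then if r == p then None else Some (succ r)
              else Some (succ p))
    (crossing K) (@kind K) (fun v => Some (strand v)).

Definition follows (reversed : bool) (p q : point K) : Prop :=
  if reversed then succ q = p else succ p = q.

End Diagram.

Definition swap_strands (K : diagram) (y : crossing K) : diagram :=
  restrand (fun v => if v.1 == y then strand (y, ~~ v.2) else strand v).

Inductive redrawing : diagram -> diagram -> Prop :=
| Isotopy K K' (h : point K -> point K') (g : crossing K -> crossing K') :
    bijective h -> bijective g ->
    (forall p, h (succ p) = succ (h p)) ->
    (forall x, kind (g x) = kind x) ->
    (forall x i, strand (g x, i) = h (strand (x, i))) ->
    redrawing K K'
| AddPoint K (p : point K) : redrawing K (add_point p).

Definition cancelling (e e' : option bool) : bool :=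
  match e, e' with
  | Some b, Some b' => b != b'
  | None, None => true
  | _, _ => false
  end.

(* The lines 0, 1, 2 of the triangle have directions at increasing angles in *)
(* a half-turn; o tells for each line whether it is oriented against that    *)
(* direction.  Thus line i is strand (o i != o j) of its crossing with line  *)
(* j > i, and line j is the other one.                                       *)
Definition first_strand (o : 'I_3 -> bool) (i j : 'I_3) : bool := o i (+) o j.

(* The sign of the classical crossing of lines i < j of different heights.   *)
Definition height_sign (o : 'I_3 -> bool) (height : 'I_3 -> nat) (i j : 'I_3) :=
  (height j < height i)%N (+) first_strand o i j.

Definition line0 : 'I_3 := inord 0.
Definition line1 : 'I_3 := inord 1.
Definition line2 : 'I_3 := inord 2.

(* The kinds e01, e02, e12 of the crossings of the three lines in a          *)
(* classical, virtual or mixed third move.                                   *)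
Definition triangle_kinds (o : 'I_3 -> bool) (e01 e02 e12 : option bool) :
    Prop :=
  (exists2 height : 'I_3 -> nat, injective height &
     [/\ e01 = Some (height_sign o height line0 line1),
         e02 = Some (height_sign o height line0 line2) &
         e12 = Some (height_sign o height line1 line2)])
  \/ [/\ e01 = None & e02 = None]
  \/ [/\ e01 = None & e12 = None]
  \/ [/\ e02 = None & e12 = None].

(* Each move is listed in one direction: the first two as the removal of the *)
(* crossings, the third one from one of the two triangles to the other.      *)
Inductive reidemeister : diagram -> diagram -> Prop :=
| Kink K (x : crossing K) i :
    succ (strand (x, i)) = strand (x, ~~ i) ->
    reidemeister K (erase [set x])
| Bigon K (x y : crossing K) (r r' : bool) :
    x != y -> cancelling (kind x) (kind y) ->
    follows r (strand (x, false)) (strand (y, true)) ->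
    follows r' (strand (x, true)) (strand (y, false)) ->
    reidemeister K (erase [set x; y])
| Triangle K (x01 x02 x12 : crossing K) (o : 'I_3 -> bool) :
    uniq [:: x01; x02; x12] ->
    triangle_kinds o (kind x01) (kind x02) (kind x12) ->
    let p01 := strand (x01, first_strand o line0 line1) in
    let p10 := strand (x01, ~~ first_strand o line0 line1) in
    let p02 := strand (x02, first_strand o line0 line2) in
    let p20 := strand (x02, ~~ first_strand o line0 line2) in
    let p12 := strand (x12, first_strand o line1 line2) in
    let p21 := strand (x12, ~~ first_strand o line1 line2) in
    follows (o line0) p01 p02 ->
    follows (o line1) p10 p12 ->
    follows (o line2) p20 p21 ->
    reidemeister K (restrand (fun v =>
      tperm p01 p02 (tperm p10 p12 (tperm p20 p21 (strand v))))).

(* The classical crossing y between the virtual crossings x and z is         *)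
(* replaced by a single crossing of the same sign: erasing x and z           *)
(* interchanges the directions from which the two strands arrive at y.  The  *)
(* flanking crossings lie on the incoming and on the outgoing side of y, or  *)
(* on its left and right sides (second case).                                *)
Inductive virtualization : diagram -> diagram -> Prop :=
| Virtualize K (x y z : crossing K) (xy : y \notin [set x; z]) :
    x != z -> kind x = None -> kind z = None -> kind y != None ->
    succ (strand (x, false)) = strand (y, true) ->
    succ (strand (y, true)) = strand (z, false) ->
    (succ (strand (x, true)) = strand (y, false) /\
       succ (strand (y, false)) = strand (z, true)) \/
    (succ (strand (z, true)) = strand (y, false) /\
       succ (strand (y, false)) = strand (x, true)) ->
    virtualization K (@swap_strands (erase [set x; z]) (exist _ y xy)).

Definition elementary_move (K K' : diagram) : Prop :=
  [\/ redrawing K K', reidemeister K K' | virtualization K K'].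

Record virtual_link_diagram := VirtualLinkDiagram {
  underlying :> diagram;
  _ : well_formed underlying }.

Definition move_equivalent :
    virtual_link_diagram -> virtual_link_diagram -> Prop :=
  clos_refl_sym_trans virtual_link_diagram
    (fun K K' => elementary_move (underlying K) (underlying K')).

(* Main.v *)
Require Import Defs.
From mathcomp Require Import zify.
Set Implicit Arguments.
Unset Strict Implicit.
Unset Printing Implicit Defensive.
Import GRing.Theory.
Local Open Scope ring_scope.

(** The two sides of a move differ inside a small part of the diagram.  Once a
    state has been chosen at every crossing outside that part, both brackets
    become combinations of webs that share everything but a tangle, and it
    suffices that the relations satisfied by f (circle, bigon, quadrilateral)
    identify the two combinations of tangles.  For the first move this is
      A^(2e) (A^6 + 1 + A^(-6)) - A^(-e) (A^3 + A^(-3)) = A^(8e),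
    the factor that the writhe removes.  For the second move the unwanted
    resolutions cancel.  For the third one, both sides are expanded until no
    circle, bigon or quadrilateral is left, and the results coincide term by
    term.  Virtualization exchanges the two incoming and the two outgoing edges
    of a crossing, which changes neither of its local states as a graph.

    The proof makes this argument uniform.  A web is presented by the list of
    its arcs, so that placing a tangle T in a context C is the concatenation
    T ++ C.  The point is that the relations may be applied to T without any
    knowledge of C, provided that T ++ C is a web: the degrees allowed in a web
    leave no room for further arcs at the vertices involved
    (evaluate_contract, evaluate_loop, evaluate_bigon, evaluate_quad).  Hence
    there is an algorithm that reduces combinations of tangles and compares
    their normal forms, and same_value_sound says that a successful comparison
    holds in every context.

    A diagram is turned into a list of crossings, each of which contributes the
    two arc lists of its local states; normalized_bracket_value identifies the
    normalized bracket with the expansion of this list.  By diagram_move, a move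
    between two diagrams on the same marked points leaves the normalized bracket
    unchanged as soon as one local comparison succeeds.  The tangles have at
    most six marked points, so the comparisons for all signs and orientations
    (kink_check, bigon_check, classical_triangle_check, virtual_triangle_check,
    virtualization_check) are finite computations. *)

(** * Webs as lists of arcs *)

(** The names (p, Some false), (p, None) and (p, Some true) stand for the
    incoming port, the vertex and the outgoing port of the marked point
    numbered p. *)
Definition node_name : Type := (nat * option bool)%type.

(** Lists of arcs make gluing trivial: parts of a graph that share some nodes
    are glued by concatenation. *)
Definition arc_list : Type := seq (node_name * node_name).

Definition in_count (E : arc_list) (v : node_name) : nat := count (fun a => a.2 == v) E.
Definition out_count (E : arc_list) (v : node_name) : nat := count (fun a => a.1 == v) E.

(** The case (0, 0) is that of a name which is not a node of the graph. *)
Definition web_degrees (i o : nat) : bool :=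
  [|| (i == 0) && (o == 0), (i == 1) && (o == 1),
      (i == 0) && (o == 3) | (i == 3) && (o == 0)]%N.

Definition web_list (E : arc_list) : Prop :=
  forall v, web_degrees (in_count E v) (out_count E v).

Definition nodes (E : arc_list) : seq node_name := unzip1 E ++ unzip2 E.

Lemma src_in_nodes (E : arc_list) (i : 'I_(size E)) : (tnth (in_tuple E) i).1 \in nodes E.
Proof. by rewrite mem_cat map_f // mem_tnth. Qed.

Lemma tgt_in_nodes (E : arc_list) (i : 'I_(size E)) : (tnth (in_tuple E) i).2 \in nodes E.
Proof. by rewrite mem_cat (map_f snd) ?orbT // mem_tnth. Qed.

Definition list_graph (E : arc_list) : digraph :=
  @Digraph (seq_sub (nodes E)) 'I_(size E)
    (fun i => SeqSub (src_in_nodes i)) (fun i => SeqSub (tgt_in_nodes i)).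

Definition arcs_of (G : digraph) (h : node G -> node_name) : arc_list :=
  [seq (h (src a), h (tgt a)) | a <- enum (arc G)].

(** The last condition excludes isolated vertices, which an arc list cannot
    express. *)
Definition presents (G : digraph) (h : node G -> node_name) (E : arc_list) : Prop :=
  [/\ injective h, perm_eq (arcs_of h) E & forall v, h v \in nodes E].

Lemma list_graph_presents E : presents (G := list_graph E) val E.
Proof.
split; [exact: val_inj | | by move=> v; apply: valP].
suff -> : arcs_of (G := list_graph E) val = E by [].
rewrite /arcs_of /=; under eq_map => i do rewrite -surjective_pairing.
exact: (map_tnth_enum (in_tuple E)).
Qed.

Lemma in_countP E v : (0 < in_count E v)%N = (v \in unzip2 E).
Proof.
rewrite -has_count; apply/hasP/mapP => [[a aE /eqP <-]|[a aE ->]]; by exists a.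
Qed.

Lemma out_countP E v : (0 < out_count E v)%N = (v \in unzip1 E).
Proof.
rewrite -has_count; apply/hasP/mapP => [[a aE /eqP <-]|[a aE ->]]; by exists a.
Qed.

Lemma in_count_perm E E' v : perm_eq E E' -> in_count E v = in_count E' v.
Proof. by move=> EE'; apply: (elimT seq.permP EE'). Qed.

Lemma out_count_perm E E' v : perm_eq E E' -> out_count E v = out_count E' v.
Proof. by move=> EE'; apply: (elimT seq.permP EE'). Qed.

Lemma web_list_perm E E' : perm_eq E E' -> web_list E -> web_list E'.
Proof.
by move=> EE' wE v; rewrite -(in_count_perm v EE') -(out_count_perm v EE').
Qed.

Lemma nodes_perm E E' : perm_eq E E' -> nodes E =i nodes E'.
Proof.
by move=> EE' v; rewrite !mem_cat !(perm_mem (perm_map _ EE')).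
Qed.

Lemma indeg_arcs_of G (h : node G -> node_name) v :
  injective h -> indeg v = in_count (arcs_of h) (h v).
Proof.
move=> hI; rewrite /in_count count_map enumT /indeg cardE /enum_mem size_filter.
by apply: eq_count => a; rewrite /= inE (inj_eq hI).
Qed.

Lemma outdeg_arcs_of G (h : node G -> node_name) v :
  injective h -> outdeg v = out_count (arcs_of h) (h v).
Proof.
move=> hI; rewrite /out_count count_map enumT /outdeg cardE /enum_mem size_filter.
by apply: eq_count => a; rewrite /= inE (inj_eq hI).
Qed.

Lemma presents_web G h E : presents (G := G) h E -> web_list E -> web G.
Proof.
case=> hI GE hE wE; apply/forallP => v.
rewrite /trivalent /bivalent !xpair_eqE (indeg_arcs_of v hI) (outdeg_arcs_of v hI).
rewrite (in_count_perm _ GE) (out_count_perm _ GE).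
have := wE (h v); have := hE v; rewrite mem_cat -in_countP -out_countP.
by rewrite /web_degrees; lia.
Qed.

(** The injective namings identify the vertices, and any permutation between
    the two lists of named arcs identifies the arcs. *)
Lemma presents_iso G H g h E :
  presents (G := G) g E -> presents (G := H) h E -> digraph_iso G H.
Proof.
move=> [gI GE gE] [hI HE hE].
have nodesG : forall L (l : node L -> node_name), injective l ->
    perm_eq (arcs_of l) E -> (forall v, l v \in nodes E) ->
    perm_eq (codom l) (undup (nodes E)).
  move=> L l lI LE lE; apply: uniq_perm; rewrite ?undup_uniq //.
    by rewrite map_inj_uniq ?enum_uniq.
  move=> v; rewrite mem_undup; apply/codomP/idP => [[u ->]//|].
  rewrite -(nodes_perm LE) mem_cat => /orP[] /mapP[a /mapP[b _ ->] ->].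
    by exists (src b).
  by exists (tgt b).
have GH : perm_eq (codom g) (codom h).
  by rewrite (permPl (nodesG _ _ gI GE gE)) perm_sym nodesG.
have hg u : exists v, h v == g u.
  have : g u \in codom h by rewrite -(perm_mem GH) codom_f.
  by case/codomP => v ->; exists v.
pose p u := xchoose (hg u).
have pE u : h (p u) = g u by apply/eqP: (xchooseP (hg u)).
have sAr : size (arcs_of g) = size (arcs_of h).
  by apply: perm_size; rewrite (permPl GE) perm_sym.
have cA : #|arc G| = #|arc H| by rewrite !cardE; move: sAr; rewrite !size_map.
have /tuple_permP[/= s sE] : perm_eq (arcs_of g) (in_tuple (arcs_of h)).
  by rewrite (permPl GE) perm_sym.
have cH : size (arcs_of h) = #|arc H| by rewrite cardE size_map.
have cG : #|arc G| = size (arcs_of h) by rewrite cA cH.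
pose k a := enum_val (cast_ord cH (s (cast_ord cG (enum_rank a)))).
have kE a : (h (src (k a)), h (tgt (k a))) = (g (src a), g (tgt a)).
  have x0 := (g (src a), g (tgt a)).
  rewrite -[RHS](congr1 (fun b => (g (src b), g (tgt b))) (enum_rankK a)).
  rewrite -(nth_codom x0 (fun b => (g (src b), g (tgt b)))) -[codom _]/(arcs_of g).
  rewrite sE (nth_map (cast_ord cG (enum_rank a))) ?size_enum_ord -?cG //.
  rewrite (nth_ord_enum _ (cast_ord cG (enum_rank a))) (tnth_nth x0) /=.
  exact/esym/(nth_codom x0 (fun b => (h (src b), h (tgt b))) (cast_ord cH _)).
apply/existsP; exists [ffun u => p u]; apply/existsP; exists [ffun a => k a].
rewrite cA eqxx -(size_codom g) -(size_codom h) (perm_size GH) eqxx /=.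
apply/and3P; split.
- apply/injectiveP => u v; rewrite !ffunE => puv.
  by apply: gI; rewrite -!pE puv.
- apply/injectiveP => a b; rewrite !ffunE => /enum_val_inj /cast_ord_inj.
  by move/perm_inj/cast_ord_inj/enum_rank_inj.
- apply/forallP => a; rewrite !ffunE -!(inj_eq hI) !pE.
  by case: (kE a) => -> ->; rewrite !eqxx.
Qed.

Lemma arcs_of_enum G (h : node G -> node_name) (s : seq (arc G)) :
  uniq s -> (forall a, a \in s) ->
  perm_eq (arcs_of h) [seq (h (src a), h (tgt a)) | a <- s].
Proof.
move=> sU sT; apply: perm_map; apply: uniq_perm; rewrite ?enum_uniq // => a.
by rewrite mem_enum sT.
Qed.

Lemma tnth_cons_lift (a : node_name * node_name) (E : arc_list) (i : 'I_(size E)) :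
  tnth (in_tuple (a :: E)) (lift ord0 i) = tnth (in_tuple E) i.
Proof. by rewrite !(tnth_nth a). Qed.

Lemma map_enum_tnth (T : Type) (E : arc_list) (g : 'I_(size E) -> T) F :
  (forall i, g i = F (tnth (in_tuple E) i)) ->
  [seq g i | i <- enum 'I_(size E)] = map F E.
Proof. by move=> gF; rewrite (eq_map gF) (map_comp F) (map_tnth_enum (in_tuple E)). Qed.

Lemma mem_nodes_cons v a (E : arc_list) :
  (v \in nodes (a :: E)) = [|| v == a.1, v == a.2 | v \in nodes E].
Proof. by rewrite /nodes !mem_cat /= !inE -!orbA; do !bool_congr. Qed.

(** Used for the arcs that lie beyond the few that a local move affects. *)
Lemma map_filter_shift n (E : arc_list) (k : 'I_(size E) -> 'I_n) (P : pred 'I_n) F :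
  (forall i, P (k i)) -> (forall i, F (k i) = tnth (in_tuple E) i) ->
  [seq F a | a <- [seq k i | i <- enum 'I_(size E)] & P a] = E.
Proof.
move=> Pk Fk; rewrite filter_map (eq_filter (a2 := predT)) // filter_predT -map_comp.
by rewrite -[RHS]map_id; apply: map_enum_tnth.
Qed.

Lemma enum_ordSS n :
  enum 'I_n.+2 = [:: ord0, lift ord0 ord0 & [seq lift ord0 (lift ord0 i) | i <- enum 'I_n]].
Proof. by rewrite !enum_ordSl map_cons -map_comp. Qed.

Lemma enum_ordSSSS n :
  enum 'I_n.+4 = [:: ord0, lift ord0 ord0, lift ord0 (lift ord0 ord0),
    lift ord0 (lift ord0 (lift ord0 ord0)) &
    [seq lift ord0 (lift ord0 (lift ord0 (lift ord0 i))) | i <- enum 'I_n]].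
Proof. by rewrite !enum_ordSS !map_cons -!map_comp. Qed.

(** * The relations on lists of arcs *)

Section Evaluation.
Variables (f : digraph -> graph_poly) (fP : graph_evaluation f).

Definition evaluate (E : arc_list) : graph_poly := f (list_graph E).

(** This transports f to arc lists: every graph with a presentation may be
    replaced by the canonical graph of its list. *)
Lemma presents_evaluate G h E :
  presents (G := G) h E -> web_list E -> f G = evaluate E.
Proof.
move=> GE wE; have EE := list_graph_presents E.
apply: (eval_iso fP); [exact: presents_web GE wE | exact: presents_web EE wE |].
exact: presents_iso GE EE.
Qed.

Lemma evaluate_perm E E' : perm_eq E E' -> web_list E -> evaluate E = evaluate E'.
Proof.
move=> EE' wE; have [vI vE vN] := list_graph_presents E.
apply: (@presents_evaluate (list_graph E) val); last exact: web_list_perm wE.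
by split=> [//| |v]; rewrite ?(permPl vE) // -(nodes_perm EE').
Qed.

Lemma in_count_map g E v :
  injective g -> in_count [seq (g a.1, g a.2) | a <- E] (g v) = in_count E v.
Proof.
by move=> gI; rewrite /in_count count_map; apply: eq_count => a /=; rewrite inj_eq.
Qed.

Lemma out_count_map g E v :
  injective g -> out_count [seq (g a.1, g a.2) | a <- E] (g v) = out_count E v.
Proof.
by move=> gI; rewrite /out_count count_map; apply: eq_count => a /=; rewrite inj_eq.
Qed.

Lemma web_list_map g E :
  injective g -> web_list E -> web_list [seq (g a.1, g a.2) | a <- E].
Proof.
move=> gI wE v; have [vE|] := boolP (v \in nodes [seq (g a.1, g a.2) | a <- E]).
  have [w ->] : exists w, v = g w.
    move: vE; rewrite mem_cat => /orP[] /mapP[_ /mapP[a _ ->] ->] /=; last by exists a.2.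
    by exists a.1.
  by rewrite in_count_map // out_count_map.
by rewrite mem_cat -in_countP -out_countP negb_or -!eqn0Ngt => /andP[/eqP -> /eqP ->].
Qed.

Lemma evaluate_map g E :
  injective g -> web_list E -> evaluate [seq (g a.1, g a.2) | a <- E] = evaluate E.
Proof.
move=> gI wE; have [vI vE vN] := list_graph_presents E.
apply/esym; apply: (@presents_evaluate (list_graph E) (g \o val)); last exact: web_list_map.
split=> [|| v]; first exact: inj_comp.
  by have := perm_map (fun a => (g a.1, g a.2)) vE; rewrite /arcs_of -map_comp.
have := vN v; rewrite !mem_cat -!in_countP -!out_countP /=.
by rewrite in_count_map // out_count_map.
Qed.

(** A node with an incoming and an outgoing arc is bivalent in any web, so it
    occurs in no other arc and the left-hand graph is a subdivision of the
    right-hand one.  This is why no freshness condition on v is needed, and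
    why this rewriting is valid whatever the rest E of the web is. *)
Lemma evaluate_contract u v w E :
  web_list [:: (u, v), (v, w) & E] ->
  web_list ((u, w) :: E) /\
  evaluate [:: (u, v), (v, w) & E] = evaluate ((u, w) :: E).
Proof.
move=> wE.
have wE' : web_list ((u, w) :: E).
  move=> x; have := wE x; have := wE v; rewrite /web_degrees /in_count /out_count /= !eqxx.
  by case: (altP (v =P x)) => [<-|_]; lia.
have vE : v \notin nodes ((u, w) :: E).
  rewrite mem_cat -in_countP -out_countP.
  by have := wE v; rewrite /web_degrees /in_count /out_count /= !eqxx; lia.
have wG : web (list_graph ((u, w) :: E)).
  exact: presents_web (list_graph_presents _) wE'.
split=> //; pose e : arc (list_graph ((u, w) :: E)) := ord0.
rewrite [RHS]/evaluate -(eval_subdivide fP e wG).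
pose h (x : option (seq_sub (nodes ((u, w) :: E)))) := if x is Some y then val y else v.
apply/esym/(@presents_evaluate (subdivide e) h) => //.
split=> [[x|] [y|] //||].
- by move/val_inj ->.
- by rewrite /h => xv; rewrite -xv (valP x) in vE.
- by rewrite /h => yv; rewrite yv (valP y) in vE.
- pose s : seq (option 'I_(size E).+1) := None :: [seq Some i | i : 'I_(size E).+1].
  apply: perm_trans (@arcs_of_enum (subdivide e) h s _ _) _.
  + by rewrite /= map_inj_uniq ?enum_uniq ?andbT; [apply/mapP => -[] | apply: Some_inj].
  + by case=> [i|]; rewrite inE // map_f // mem_enum.
  rewrite /s /image_mem enum_ordSl /= -2!map_comp.
  rewrite (perm_catCA [:: _] [:: _]) /= !perm_cons.
  set s' := map _ _; suff -> : s' = E by [].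
  rewrite -[RHS]map_id; apply: map_enum_tnth => i /=.
  by rewrite tnth_cons_lift -surjective_pairing.
- case=> [x|]; last by rewrite !mem_nodes_cons eqxx orbT.
  have := valP x; rewrite -[X in X -> _]/(is_true (val x \in _)) /= !mem_nodes_cons /=.
  by case/or3P => ->; rewrite ?orbT.
Qed.

(** In a web the node of a loop is bivalent, hence it is a circle apart from
    the rest. *)
Lemma evaluate_loop v E :
  web_list ((v, v) :: E) ->
  web_list E /\
  evaluate ((v, v) :: E) = (Apow 6 + 1 + Apow (-6)) *: evaluate E.
Proof.
move=> wE.
have wE' : web_list E.
  move=> x; have := wE x; have := wE v; rewrite /web_degrees /in_count /out_count /= !eqxx.
  by case: (altP (v =P x)) => [<-|_]; lia.
have vE : v \notin nodes E.
  rewrite mem_cat -in_countP -out_countP.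
  by have := wE v; rewrite /web_degrees /in_count /out_count /= !eqxx; lia.
split=> //; rewrite -mul_malgC -(eval_circle fP) -(eval_union fP); first last.
- exact: presents_web (list_graph_presents _) wE'.
- apply: (@presents_web circle (fun=> v) [:: (v, v)]); last first.
    by move=> x; rewrite /web_degrees /in_count /out_count /=; case: (v == x).
  split=> [[] []|| _] //; last by rewrite mem_nodes_cons eqxx.
  by apply: perm_trans (@arcs_of_enum circle _ [:: tt] _ _) _ => // -[].
pose h (x : unit + seq_sub (nodes E)) := if x is inr y then val y else v.
apply/esym/(@presents_evaluate (disjoint_union circle (list_graph E)) h) => //.
split=> [[[]|x] [[]|y] //|| [[]|x]].
- by rewrite /h => vy; rewrite vy (valP y) in vE.
- by rewrite /h => xv; rewrite -xv (valP x) in vE.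
- by move/val_inj ->.
- pose s : seq (unit + 'I_(size E)) := inl tt :: [seq inr i | i : 'I_(size E)].
  apply: perm_trans (@arcs_of_enum (disjoint_union circle (list_graph E)) h s _ _) _.
  + by rewrite /= map_inj_uniq ?enum_uniq ?andbT; [apply/mapP => -[] | move=> x y []].
  + by case=> [[]|i]; rewrite inE // map_f // mem_enum.
  rewrite /s /image_mem /= -map_comp perm_cons.
  set s' := map _ _; suff -> : s' = E by [].
  rewrite -[RHS]map_id; apply: map_enum_tnth => i /=.
  by rewrite -surjective_pairing.
- by rewrite mem_nodes_cons eqxx.
- by rewrite mem_nodes_cons (valP x) !orbT.
Qed.

Lemma arcs_of_splice G (h : node G -> node_name) (D S : {set arc G}) :
  perm_eq (arcs_of (G := splice D S) h)
    [seq if a \in S then (h (tgt a), h (src a)) else (h (src a), h (tgt a))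
       | a <- enum (arc G) & a \notin D].
Proof.
have valE : perm_eq [seq val a | a : {a : arc G | a \notin D}]
                    [seq a <- enum (arc G) | a \notin D].
  apply: uniq_perm.
  - by rewrite map_inj_uniq ?enum_uniq //; apply: val_inj.
  - exact/filter_uniq/enum_uniq.
  move=> a; rewrite mem_filter mem_enum andbT.
  apply/mapP/idP => [[b _ ->]|aD]; first exact: (valP b).
  by exists (Sub a aD); rewrite ?mem_enum ?SubK.
apply: perm_trans (perm_map _ valE); rewrite -map_comp.
set s := (X in perm_eq _ X); suff -> : arcs_of (G := splice D S) h = s by [].
by apply: eq_map => a /=; case: ifP.
Qed.

Lemma evaluate_bigon u v E :
  web_list [:: (u, v), (u, v) & E] ->
  web_list ((v, u) :: E) /\
  evaluate [:: (u, v), (u, v) & E] = (Apow 3 + Apow (-3)) *: evaluate ((v, u) :: E).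
Proof.
move=> wE.
have wE' : web_list ((v, u) :: E).
  move=> x; have := wE x; rewrite /web_degrees /in_count /out_count /=.
  by case: (u == x); case: (v == x); lia.
split=> //; set G := list_graph [:: (u, v), (u, v) & E].
have wG : web G by exact: presents_web (list_graph_presents _) wE.
pose a : arc G := ord0; pose b : arc G := lift ord0 ord0.
have ab : is_bigon a b by rewrite /is_bigon -!val_eqE /= !eqxx.
rewrite -mul_malgC [LHS](eval_bigon fP wG ab); congr (_ * _).
apply: (@presents_evaluate (splice [set b] [set a]) val) => //.
split=> [||x]; first exact: val_inj.
- apply: perm_trans (arcs_of_splice _ _ _) _.
  rewrite [X in filter _ X](enum_ordSS (size E)).
  rewrite /= !inE -!val_eqE /= !inE -!val_eqE /= map_filter_shift //= => i.
    by rewrite !inE -!val_eqE.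
  by rewrite !inE -!val_eqE /= !(tnth_nth (u, v)) /= -surjective_pairing.
- have := valP x; rewrite -[X in X -> _]/(is_true (val x \in _)) /= !mem_nodes_cons /=.
  by case/or4P => [->|->|->|/orP[] ->]; rewrite ?orbT.
Qed.

(** The 4-cycle runs through s, t, s', t' with sources s and s'.  After two
    opposite sides are deleted and the other two reversed, the four corners
    are bivalent. *)
Lemma evaluate_quad s t s' t' E :
  s != s' -> t != t' ->
  web_list [:: (s, t), (s', t), (s', t'), (s, t') & E] ->
  [/\ web_list [:: (t, s), (t', s') & E], web_list [:: (t, s'), (t', s) & E] &
  evaluate [:: (s, t), (s', t), (s', t'), (s, t') & E] =
    evaluate [:: (t, s), (t', s') & E] + evaluate [:: (t, s'), (t', s) & E]].
Proof.
move=> ss tt wE.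
have sx x : ~~ ((s == x) && (s' == x)).
  by apply/negP => /andP[/eqP e1 /eqP e2]; rewrite e1 e2 eqxx in ss.
have tx x : ~~ ((t == x) && (t' == x)).
  by apply/negP => /andP[/eqP e1 /eqP e2]; rewrite e1 e2 eqxx in tt.
have w1 : web_list [:: (t, s), (t', s') & E].
  move=> x; have := wE x; rewrite /web_degrees /in_count /out_count /=.
  move: (sx x) (tx x).
  by case: (s == x); case: (s' == x); case: (t == x); case: (t' == x) => //=; lia.
have w2 : web_list [:: (t, s'), (t', s) & E].
  move=> x; have := wE x; rewrite /web_degrees /in_count /out_count /=.
  move: (sx x) (tx x).
  by case: (s == x); case: (s' == x); case: (t == x); case: (t' == x) => //=; lia.
split=> //; set G := list_graph [:: (s, t), (s', t), (s', t'), (s, t') & E].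
have wG : web G by exact: presents_web (list_graph_presents _) wE.
pose a : arc G := ord0; pose b : arc G := lift ord0 ord0.
pose c : arc G := lift ord0 (lift ord0 ord0).
pose d : arc G := lift ord0 (lift ord0 (lift ord0 ord0)).
have abcd : is_quad a b c d.
  by rewrite /is_quad -!val_eqE /= !eqxx ss tt.
rewrite [LHS](eval_quad fP wG abcd); congr (_ + _).
- apply: (@presents_evaluate (splice [set b; d] [set a; c]) val) => //.
  split=> [||x]; first exact: val_inj.
    apply: perm_trans (arcs_of_splice _ _ _) _.
    rewrite [X in filter _ X](enum_ordSSSS (size E)).
    rewrite /= !inE -!val_eqE /= !inE -!val_eqE /= map_filter_shift //= => i.
      by rewrite !inE -!val_eqE.
    by rewrite !inE -!val_eqE /= !(tnth_nth (s, t)) /= -surjective_pairing.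
  have := valP x; rewrite -[X in X -> _]/(is_true (val x \in _)) /= !mem_nodes_cons /=.
  by do ?[case/orP => [->|]; first by rewrite ?orbT]; move=> ->; rewrite ?orbT.
- apply: (@presents_evaluate (splice [set a; c] [set b; d]) val) => //.
  split=> [||x]; first exact: val_inj.
    apply: perm_trans (arcs_of_splice _ _ _) _.
    rewrite [X in filter _ X](enum_ordSSSS (size E)).
    rewrite /= !inE -!val_eqE /= !inE -!val_eqE /= map_filter_shift //= => i.
      by rewrite !inE -!val_eqE.
    by rewrite !inE -!val_eqE /= !(tnth_nth (s, t)) /= -surjective_pairing.
  have := valP x; rewrite -[X in X -> _]/(is_true (val x \in _)) /= !mem_nodes_cons /=.
  by do ?[case/orP => [->|]; first by rewrite ?orbT]; move=> ->; rewrite ?orbT.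
Qed.
End Evaluation.

(** * Reducing tangles by computation *)

Lemma ApowS (z : int) : Apow (z + 1) = Apow z * varA.
Proof.
case: z => [n|[|n]]; first by rewrite -PoszD addn1 /= exprSr.
  by rewrite /= expr1 mulrC varA_inv.
have -> : Negz n.+1 + 1 = Negz n by lia.
by rewrite /= [varAinv ^+ n.+2]exprSr -mulrA [varAinv * _]mulrC varA_inv mulr1.
Qed.

Lemma ApowB1 (z : int) : Apow (z - 1) = Apow z * varAinv.
Proof.
by rewrite -{2}(subrK 1 z) ApowS -mulrA varA_inv mulr1.
Qed.

Lemma ApowD (y z : int) : Apow (y + z) = Apow y * Apow z.
Proof.
elim/int_rect: z => [|n IHn|n IHn]; first by rewrite addr0 mulr1.
  by rewrite -addn1 PoszD addrA !ApowS IHn mulrA.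
by rewrite -addn1 PoszD opprD addrA !ApowB1 IHn mulrA.
Qed.

(** The term ((b, z), T) stands for (-1)^b A^z times the arcs T. *)
Definition term : Type := ((bool * int) * arc_list)%type.

Definition mul_coef (c d : bool * int) : bool * int := (c.1 (+) d.1, c.2 + d.2).

Definition scale_term (c : bool * int) (t : term) : term := (mul_coef c t.1, t.2).

(** The first applicable reduction among: remove a circle, contract a bivalent
    vertex, resolve a bigon, resolve a quadrilateral.  In the last case a and c
    are two opposite sides of the quadrilateral. *)
Definition step (T : arc_list) : option (seq term) :=
  if [seq a <- T | a.1 == a.2] is a :: _ then
    Some [seq ((false, z), rem a T) | z <- [:: 6; 0; -6]]
  else if [seq ab <- [seq (a, b) | a <- T, b <- rem a T] | ab.1.2 == ab.2.1]
      is (a, b) :: _ then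
    Some [:: ((false, 0), (a.1, b.2) :: rem b (rem a T))]
  else if [seq a <- T | a \in rem a T] is a :: _ then
    Some [seq ((false, z), (a.2, a.1) :: rem a (rem a T)) | z <- [:: 3; -3]]
  else if [seq ac <- [seq (a, c) | a <- T, c <- T] |
      [&& ac.1.1 != ac.2.1, ac.1.2 != ac.2.2,
          (ac.2.1, ac.1.2) \in T & (ac.1.1, ac.2.2) \in T]] is (a, c) :: _ then
    let T' := rem (a.1, c.2) (rem c (rem (c.1, a.2) (rem a T))) in
    Some [:: ((false, 0), [:: (a.2, a.1), (c.2, c.1) & T']);
             ((false, 0), [:: (a.2, c.1), (c.2, a.1) & T'])]
  else None.

Fixpoint reduce n (t : term) : seq term :=
  if n is n'.+1 then
    if step t.2 is Some ts then flatten [seq reduce n' (scale_term t.1 u) | u <- ts]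
    else [:: t]
  else [:: t].

Definition inp (p : nat) : node_name := (p, Some false).
Definition mid (p : nat) : node_name := (p, None).
Definition outp (p : nat) : node_name := (p, Some true).

(** A transposition of names, so that a renaming made of such swaps is
    injective whatever the indices are. *)
Definition swap_mid i j (v : node_name) : node_name :=
  if v == mid i then mid j else if v == mid j then mid i else v.

Definition mid_next_to (T : arc_list) i : seq nat :=
  [seq a.2.1 | a <- T & [&& a.1.1 == i, a.1.2 != None & a.2.2 == None]] ++
  [seq a.1.1 | a <- T & [&& a.2.1 == i, a.2.2 != None & a.1.2 == None]].

(** The vertex next to a port of the point i is renamed mid i.  When this is
    done for i = 0, ..., k - 1, a vertex next to several boundary ports ends up
    with the largest of their numbers, which depends on the reduced tangle
    only. *)
Definition relabel k (T : arc_list) i : arc_list :=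
  if [seq j <- mid_next_to T i | (i < k) && (j < k)]%N is j :: _ then
    [seq (swap_mid i j a.1, swap_mid i j a.2) | a <- T]
  else T.

Definition node_key (v : node_name) : nat :=
  (3 * v.1 + (if v.2 is Some b then b.+1 else 0))%N.
Definition arc_le (a b : node_name * node_name) : bool :=
  ((node_key a.1 < node_key b.1) ||
   ((node_key a.1 == node_key b.1) && (node_key a.2 <= node_key b.2)))%N.

(** Two reduced tangles that differ by the names of the inner vertices or the
    order of the arcs become equal, provided that each inner vertex is joined
    to the boundary. *)
Definition canonical k (t : term) : term :=
  (t.1, sort arc_le (foldl (relabel k) t.2 (iota 0 k))).

(** The bound 60 on the number of reductions exceeds what is needed for three
    crossings; a smaller one could only make a comparison fail. *)
Definition normal_form k (ts : seq term) : seq term :=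
  [seq canonical k t | t <- flatten [seq reduce 60 t | t <- ts]].

Definition signed_part (b : bool) (ts : seq term) : seq (int * arc_list) :=
  [seq (t.1.2, t.2) | t <- ts & t.1.1 == b].

(** The coefficients are signed powers of A, so two combinations agree as soon
    as the positive terms of one with the negative terms of the other are a
    permutation of the remaining terms. *)
Definition same_value k (ts us : seq term) : bool :=
  let ts' := normal_form k ts in let us' := normal_form k us in
  perm_eq (signed_part false ts' ++ signed_part true us')
          (signed_part true ts' ++ signed_part false us').

Lemma subr_cross (V : zmodType) (a b c d : V) : a + d = b + c -> a - b = c - d.
Proof. by move=> E; apply/eqP; rewrite subr_eq addrAC -subr_eq opprK E addrC. Qed.

Section Soundness.
Variables (f : digraph -> graph_poly) (fP : graph_evaluation f).
Variable C : arc_list.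

Definition coef (c : bool * int) : laurent := (-1) ^+ c.1 * Apow c.2.

Definition term_value (t : term) : graph_poly := coef t.1 *: evaluate f (t.2 ++ C).

Definition value (ts : seq term) : graph_poly := \sum_(t <- ts) term_value t.

Definition webs (ts : seq term) : Prop := {in ts, forall t, web_list (t.2 ++ C)}.

Lemma coefM c d : coef (mul_coef c d) = coef c * coef d.
Proof. by rewrite /coef /mul_coef signr_addb ApowD mulrACA. Qed.

Lemma term_valueZ c t : term_value (scale_term c t) = coef c *: term_value t.
Proof. by rewrite /term_value coefM scalerA. Qed.

Lemma coef_pos z : coef (false, z) = Apow z.
Proof. by rewrite /coef mul1r. Qed.

Lemma webs_nil : webs [::].
Proof. by []. Qed.

Lemma webs_cons c T ts : web_list (T ++ C) -> webs ts -> webs ((c, T) :: ts).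
Proof. by move=> wt wts u; rewrite in_cons => /predU1P[->//|/wts]. Qed.

Lemma value_seq1 c T : value [:: (c, T)] = coef c *: evaluate f (T ++ C).
Proof. exact: big_seq1. Qed.

Lemma value_cons c T ts :
  value ((c, T) :: ts) = coef c *: evaluate f (T ++ C) + value ts.
Proof. exact: big_cons. Qed.

Lemma coef_neg z : coef (true, z) = - Apow z.
Proof. by rewrite /coef expr1 mulN1r. Qed.

(** The reductions look at T only, yet they are valid in T ++ C: in a web, the
    degrees of the nodes that are met already determine all their arcs. *)
Lemma step_sound T ts :
  web_list (T ++ C) -> step T = Some ts -> webs ts /\ evaluate f (T ++ C) = value ts.
Proof.
move=> wT; rewrite /step.
case E1 : [seq a <- T | a.1 == a.2] => [|[a1 a2] s1] => [|[<-]].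
  case E2 : [seq ab <- _ | _] => [|[[a1 a2] [b1 b2]] s2] => [|[<-]].
    case E3 : [seq a <- T | _] => [|[a1 a2] s3] => [|[<-]].
      case E4 : [seq ac <- _ | _] => [//|[[a1 a2] [c1 c2]] s4] => [[<-]].
      have : (a1, a2, (c1, c2)) \in (a1, a2, (c1, c2)) :: s4 by rewrite mem_head.
      rewrite -E4 mem_filter => /andP[/and4P[/= ac1 ac2 ca_T ac_T]].
      case/allpairsP => -[a' c'] /= [aT cT [? ?]]; subst a' c'.
      set T' := rem _ _.
      have TE : perm_eq (T ++ C) [:: (a1, a2), (c1, a2), (c1, c2), (a1, c2) & T' ++ C].
        rewrite -4!cat_cons perm_cat2r (permPl (perm_to_rem aT)) perm_cons.
        have m1 : (c1, a2) \in rem (a1, a2) T.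
          by apply: rem_mem ca_T; rewrite xpair_eqE negb_and eq_sym ac1.
        rewrite (permPl (perm_to_rem m1)) perm_cons.
        have m2 : (c1, c2) \in rem (c1, a2) (rem (a1, a2) T).
          apply: rem_mem; first by rewrite xpair_eqE negb_and [c2 == _]eq_sym ac2 orbT.
          by apply: rem_mem cT; rewrite xpair_eqE negb_and eq_sym ac1.
        rewrite (permPl (perm_to_rem m2)) perm_cons.
        apply: perm_to_rem; apply: rem_mem; first by rewrite xpair_eqE negb_and ac1.
        apply: rem_mem; first by rewrite xpair_eqE negb_and ac1.
        by apply: rem_mem ac_T; rewrite xpair_eqE negb_and [c2 == _]eq_sym ac2 orbT.
      have [w1 w2 Ev] := evaluate_quad fP ac1 ac2 (web_list_perm TE wT).
      split.
        by apply: webs_cons; [exact: w1 | apply: webs_cons; [exact: w2 | exact: webs_nil]].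
      rewrite (evaluate_perm fP TE wT) Ev value_cons value_seq1.
      by rewrite coef_pos !scale1r.
    have : (a1, a2) \in (a1, a2) :: s3 by rewrite mem_head.
    rewrite -E3 mem_filter => /andP[aT2 aT].
    have TE : perm_eq (T ++ C) [:: (a1, a2), (a1, a2) & rem (a1, a2) (rem (a1, a2) T) ++ C].
      rewrite -2!cat_cons perm_cat2r.
      by rewrite (permPl (perm_to_rem aT)) perm_cons perm_to_rem.
    have [w Ev] := evaluate_bigon fP (web_list_perm TE wT).
    split; first by do 2![apply: webs_cons; first exact: w]; apply: webs_nil.
    rewrite (evaluate_perm fP TE wT) Ev value_cons value_seq1.
    by rewrite !coef_pos; exact: scalerDl.
  have : (a1, a2, (b1, b2)) \in (a1, a2, (b1, b2)) :: s2 by rewrite mem_head.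
  rewrite -E2 mem_filter => /andP[/= /eqP ?]; subst b1.
  case/allpairsPdep => [a' [b' [aT bT [? ?]]]]; subst a' b'.
  have TE : perm_eq (T ++ C) [:: (a1, a2), (a2, b2) & rem (a2, b2) (rem (a1, a2) T) ++ C].
    rewrite -2!cat_cons perm_cat2r.
    by rewrite (permPl (perm_to_rem aT)) perm_cons perm_to_rem.
  have [w Ev] := evaluate_contract fP (web_list_perm TE wT).
  split; first by apply: webs_cons; first exact: w; apply: webs_nil.
  rewrite (evaluate_perm fP TE wT) Ev value_seq1.
  by rewrite coef_pos scale1r.
have : (a1, a2) \in (a1, a2) :: s1 by rewrite mem_head.
rewrite -E1 mem_filter => /andP[/eqP /= ? aT]; subst a2.
have TE : perm_eq (T ++ C) ((a1, a1) :: rem (a1, a1) T ++ C).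
  rewrite -cat_cons perm_cat2r; exact: perm_to_rem.
have [w Ev] := evaluate_loop fP (web_list_perm TE wT).
split; first by do 3![apply: webs_cons; first exact: w]; apply: webs_nil.
rewrite (evaluate_perm fP TE wT) Ev 2!value_cons value_seq1.
rewrite !coef_pos addrA; etransitivity; first exact: scalerDl.
congr (_ + _); exact: scalerDl.
Qed.

Lemma value_flatten (s : seq (seq term)) : value (flatten s) = \sum_(ts <- s) value ts.
Proof. exact: big_flatten. Qed.

Lemma webs_flatten (s : seq (seq term)) :
  (forall ts, ts \in s -> webs ts) -> webs (flatten s).
Proof. by move=> ws t /flattenP[ts /ws]; apply. Qed.

Lemma reduce_sound n t :
  web_list (t.2 ++ C) -> webs (reduce n t) /\ term_value t = value (reduce n t).
Proof.
elim: n t => [|n IHn] [c T] wT /=.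
  by split; [apply: webs_cons; rewrite ?wT | rewrite value_seq1].
case E : (step T) => [ts|]; last first.
  by split; [apply: webs_cons; rewrite ?wT | rewrite value_seq1].
have [wts Ev] := step_sound wT E.
have IH u : u \in ts -> _ := fun ut => IHn (scale_term c u) (wts u ut).
split.
  by apply: webs_flatten => us /mapP[u ut ->]; have [] := IH u ut.
rewrite value_flatten big_map /term_value Ev scaler_sumr.
rewrite big_seq [RHS]big_seq; apply: eq_bigr => u /IH[_ <-].
by rewrite term_valueZ.
Qed.

(** The vertices of the first k points may be renamed freely when the context
    does not contain them. *)
Definition avoids k : Prop := forall i, (i < k)%N -> mid i \notin nodes C.

Lemma swap_midK i j : involutive (swap_mid i j).
Proof.
move=> v; rewrite /swap_mid; case: (v =P mid i) => [->|vi].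
  by rewrite eqxx; case: ifP => // /eqP ->.
case: (v =P mid j) => [->|/eqP /negPf vj]; first by rewrite eqxx.
by rewrite vj; case: eqP.
Qed.

Lemma evaluate_relabel k T i :
  avoids k -> web_list (T ++ C) ->
  web_list (relabel k T i ++ C) /\ evaluate f (relabel k T i ++ C) = evaluate f (T ++ C).
Proof.
move=> Ck wT; rewrite /relabel; case E : [seq j <- _ | _] => [|j s] //.
have : j \in j :: s by rewrite mem_head.
rewrite -E mem_filter => /andP[/andP[ik jk] _].
pose g := swap_mid i j.
have gI : injective g := can_inj (@swap_midK i j).
have gC : [seq (g a.1, g a.2) | a <- C] = C.
  rewrite -[RHS]map_id; apply/eq_in_map => -[u v] uvC /=.
  have fixed w : w \in nodes C -> g w = w.
    rewrite /g /swap_mid; case: eqP => [->|_]; first by rewrite (negPf (Ck i ik)).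
    by case: eqP => [->|//]; rewrite (negPf (Ck j jk)).
  by rewrite !fixed // mem_cat ?(map_f fst uvC) ?(map_f snd uvC) ?orbT.
rewrite -{1 2}gC -map_cat; split; first exact: web_list_map.
exact: evaluate_map.
Qed.

Lemma canonical_sound k t :
  avoids k -> web_list (t.2 ++ C) -> term_value (canonical k t) = term_value t.
Proof.
move=> Ck; case: t => c T /= wT.
have : web_list (foldl (relabel k) T (iota 0 k) ++ C) /\
    evaluate f (foldl (relabel k) T (iota 0 k) ++ C) = evaluate f (T ++ C).
  elim: (iota 0 k) T wT => [|i s IHs] T wT //=.
  have [wT' <-] := evaluate_relabel i Ck wT; exact: IHs.
case=> w; rewrite /canonical /term_value /= => <-; congr (_ *: _).
by apply/esym/(evaluate_perm fP) => //; rewrite perm_cat2r perm_sym perm_sort.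
Qed.

Lemma normal_form_sound k ts :
  avoids k -> webs ts -> value (normal_form k ts) = value ts.
Proof.
move=> Ck wts; rewrite /normal_form /value big_map.
have wf : webs (flatten [seq reduce 60 t | t <- ts]).
  by apply: webs_flatten => us /mapP[t /wts wt ->]; have [] := reduce_sound 60 wt.
transitivity (value (flatten [seq reduce 60 t | t <- ts])).
  rewrite big_seq [RHS]big_seq; apply: eq_bigr => t /wf; exact: canonical_sound.
rewrite value_flatten big_map big_seq [RHS]big_seq; apply: eq_bigr => t /wts wt.
by have [_] := reduce_sound 60 wt.
Qed.

Lemma value_signed_parts ts :
  value ts = \sum_(x <- signed_part false ts) Apow x.1 *: evaluate f (x.2 ++ C) -
             \sum_(x <- signed_part true ts) Apow x.1 *: evaluate f (x.2 ++ C).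
Proof.
elim: ts => [|[[b z] T] ts IH]; first by rewrite /value !big_nil subrr.
rewrite value_cons {}IH /signed_part; case: b => /=.
  by rewrite big_cons coef_neg scaleNr opprD addrCA.
by rewrite big_cons coef_pos addrA.
Qed.

Lemma same_value_sound k ts us :
  avoids k -> webs ts -> webs us -> same_value k ts us -> value ts = value us.
Proof.
move=> Ck wts wus E.
rewrite -(normal_form_sound Ck wts) -(normal_form_sound Ck wus) !value_signed_parts.
apply: subr_cross; rewrite -2!big_cat; exact: perm_big.
Qed.
End Soundness.

(** * Crossings as tangles *)

Definition straight (p : nat) : arc_list := [:: (inp p, mid p); (mid p, outp p)].

Definition pass (ps : seq nat) : arc_list := flatten [seq straight p | p <- ps].

Definition tile : Type := (option bool * (nat * nat))%type.

Definition against_sign (e : bool) (n : nat) : int := if e then - n%:Z else n%:Z.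

(** The two local states of a classical crossing of sign e through the points
    p (strand true) and q (strand false), with b telling whether the state is
    the unoriented one.  The factor A^(-8e) of the normalization is included,
    which turns the weights A^(2e) and -A^(-e) into A^(-6e) and -A^(-9e).  In
    the unoriented state p becomes the source and q the sink; in the oriented
    one the two outgoing ports are exchanged. *)
Definition tile_state (x : tile) (b : bool) : term :=
  let: (k, (p, q)) := x in
  match k with
  | None => ((false, 0), straight p ++ straight q)
  | Some e =>
    if b then
      ((true, against_sign e 9),
       [:: (inp p, mid q); (inp q, mid q); (mid p, outp p); (mid p, outp q);
           (mid p, mid q)])
    else
      ((false, against_sign e 6),
       [:: (inp p, mid p); (inp q, mid q); (mid q, outp p); (mid p, outp q)])
  end.

Definition tile_terms (x : tile) : seq term :=
  if x.1 is None then [:: tile_state x false]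
  else [:: tile_state x false; tile_state x true].

Definition unit_term : term := ((false, 0), [::]).

Definition mul_term (s t : term) : term := (mul_coef s.1 t.1, s.2 ++ t.2).

(** The state sum of a list of crossings, as a formal combination. *)
Definition expand (xs : seq tile) : seq term :=
  foldr (fun x ts => [seq mul_term s t | s <- tile_terms x, t <- ts]) [:: unit_term] xs.

Lemma mul_coefA : associative mul_coef.
Proof. by move=> a b c; rewrite /mul_coef /= addbA addrA. Qed.

Lemma mul_termA : associative mul_term.
Proof. by move=> s t u; rewrite /mul_term /= mul_coefA catA. Qed.

Lemma mul_unit_term : left_id unit_term mul_term.
Proof. by case=> -[b z] T; rewrite /mul_term /mul_coef /= add0r. Qed.

Lemma expand_cat (V : nmodType) (H : term -> V) xs ys :
  \sum_(t <- expand (xs ++ ys)) H t =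
  \sum_(s <- expand xs) \sum_(t <- expand ys) H (mul_term s t).
Proof.
elim: xs H => [|x xs IH] H /=.
  by rewrite big_seq1; apply: eq_bigr => t _; rewrite mul_unit_term.
rewrite !big_allpairs_dep; apply: eq_bigr => s _.
rewrite IH; apply: eq_bigr => t _; apply: eq_bigr => u _.
by rewrite mul_termA.
Qed.

Lemma mem_expand_cat xs ys s u :
  s \in expand xs -> u \in expand ys -> mul_term s u \in expand (xs ++ ys).
Proof.
elim: xs s => [|x xs IH] s /=; first by rewrite inE => /eqP ->; rewrite mul_unit_term.
case/allpairsP => -[a b] [/= ax bE ->] uE; rewrite -mul_termA.
by apply/allpairsP; exists (a, mul_term b u); split=> //; apply: IH.
Qed.

(** The arcs S form a tangle with ports at the points ps: it can be completed
    to a web by arcs that leave each outgoing port and enter each incoming one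
    once. *)
Definition tangle (ps : seq nat) (S : arc_list) : Prop := forall r,
  [/\ in_count S (inp r) = 0%N, out_count S (inp r) = (r \in ps),
      in_count S (outp r) = (r \in ps), out_count S (outp r) = 0%N &
      web_degrees (in_count S (mid r)) (out_count S (mid r)) /\
      (r \notin ps -> in_count S (mid r) = 0 /\ out_count S (mid r) = 0)%N].

Lemma in_count_cat S T v : in_count (S ++ T) v = (in_count S v + in_count T v)%N.
Proof. exact: count_cat. Qed.

Lemma out_count_cat S T v : out_count (S ++ T) v = (out_count S v + out_count T v)%N.
Proof. exact: count_cat. Qed.

Lemma tangle_cat ps qs S T :
  ~~ has (mem ps) qs -> tangle ps S -> tangle qs T -> tangle (ps ++ qs) (S ++ T).
Proof.
move=> pq hS hT r; rewrite !in_count_cat !out_count_cat mem_cat.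
have [-> -> -> -> [S5 S6]] := hS r; have [-> -> -> -> [T5 T6]] := hT r.
have := hasPn pq r; rewrite /= => pqr.
have {}pqr : ~~ ((r \in ps) && (r \in qs)).
  by apply/negP => /andP[rp /pqr]; rewrite rp.
case rp: (r \in ps) S6 pqr => S6; case rq: (r \in qs) T6 => T6 //= _; split=> //.
- by case: (T6 isT) => -> ->; rewrite !addn0.
- by case: (S6 isT) => -> ->.
- by case: (S6 isT) => -> ->; case: (T6 isT) => -> ->.
Qed.

Lemma tangle_straight p : tangle [:: p] (straight p).
Proof.
move=> r; rewrite /in_count /out_count /= !xpair_eqE !andbF !andbT !inE eq_sym.
by case: (r == p).
Qed.

Lemma tangle_pass ps : uniq ps -> tangle ps (pass ps).
Proof.
elim: ps => [|p ps IH] //= /andP[pps /IH].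
move=> /(tangle_cat (ps := [:: p]) _ (@tangle_straight p)) h; apply: h.
by apply/hasPn => q qps /=; rewrite inE; apply: contraNneq pps => <-.
Qed.

Definition tile_points (x : tile) : seq nat := [:: x.2.1; x.2.2].

Lemma tangle_tile x t :
  uniq (tile_points x) -> t \in tile_terms x -> tangle (tile_points x) t.2.
Proof.
case: x => -[e|] [p q]; rewrite /tile_points /= inE andbT => pq.
  rewrite !inE => /orP[] /eqP -> r; rewrite /in_count /out_count /=
    !xpair_eqE !andbF !andbT !inE ![p == r]eq_sym ![q == r]eq_sym;
  have : ~~ ((r == p) && (r == q)) by apply: contra pq => /andP[/eqP <- /eqP <-].
    by case: (r == p); case: (r == q).
  by case: (r == p); case: (r == q).
rewrite inE => /eqP -> /=.
have h := tangle_cat _ (@tangle_straight p) (@tangle_straight q).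
by apply: h; rewrite /= orbF inE eq_sym.
Qed.

Lemma tangle_expand xs t :
  uniq (flatten (map tile_points xs)) -> t \in expand xs ->
  tangle (flatten (map tile_points xs)) t.2.
Proof.
elim: xs t => [|x xs IH] t; first by rewrite inE => _ /eqP ->.
rewrite -[flatten _]/(tile_points x ++ flatten (map tile_points xs)).
rewrite cat_uniq => /and3P[ux dx uxs].
case/allpairsP => -[a b] [/= ax bE ->].
exact: tangle_cat dx (tangle_tile ux ax) (IH _ uxs bE).
Qed.

Lemma count_mem_port (b : option bool) ps (v : node_name) :
  uniq ps -> count_mem v [seq (p, b) | p <- ps] = (v.2 == b) && (v.1 \in ps) :> nat.
Proof.
move=> ups; rewrite count_uniq_mem ?map_inj_uniq //; last by move=> p q [].
case: v => r d /=; congr nat_of_bool; apply/mapP/andP => [[p pps [-> ->]]|[/eqP -> rps]].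
  by rewrite eqxx.
by exists r.
Qed.

Lemma tangle_close ps S E :
  uniq ps -> tangle ps S ->
  perm_eq (unzip1 E) (map outp ps) -> perm_eq (unzip2 E) (map inp ps) ->
  web_list (S ++ E).
Proof.
move=> ups hS Eo Ei v.
have inE' : in_count E v = (v.2 == Some false) && (v.1 \in ps) :> nat.
  by rewrite -(count_mem_port _ _ ups) -(seq.permP Ei) count_map.
have outE' : out_count E v = (v.2 == Some true) && (v.1 \in ps) :> nat.
  by rewrite -(count_mem_port _ _ ups) -(seq.permP Eo) count_map.
rewrite in_count_cat out_count_cat inE' outE'.
case: v {inE' outE'} => r [[]|] /=; have [S1 S2 S3 S4 [S5 S6]] := hS r.
- by rewrite S3 S4; case: (_ \in _).
- by rewrite S1 S2; case: (_ \in _).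
by rewrite !addn0.
Qed.

(** * The state sum as an expansion over crossings *)

Lemma sum_subsets_setU1 (T : finType) (V : nmodType) (F : {set T} -> V) x (S : {set T}) :
  x \notin S ->
  \sum_(U : {set T} | U \subset x |: S) F U =
  \sum_(U : {set T} | U \subset S) F U + \sum_(U : {set T} | U \subset S) F (x |: U).
Proof.
move=> xS; rewrite (bigID (fun U : {set T} => x \in U)) [LHS]addrC /=; congr (_ + _).
  apply: eq_bigl => U; rewrite -subsetD1; congr (U \subset _).
  by rewrite setU1K.
rewrite (reindex_onto (fun U => x |: U) (fun U => U :\ x)); last first.
  by move=> U /andP[_ xU]; rewrite setD1K.
apply: eq_bigl => U; rewrite setU11 andbT; apply/andP/idP => [[US /eqP E]|US].
  by rewrite -E -(setU1K xS) setSD.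
have xU : x \notin U by apply: contra xS; apply: (subsetP US).
by rewrite setU1K // eqxx setUS.
Qed.

Section Bracket.
Variables (K : diagram) (c : point K -> nat).

Definition tile_of (x : crossing K) : tile :=
  (kind x, (c (strand (x, true)), c (strand (x, false)))).

Definition state_term (s : seq (crossing K)) (U : {set crossing K}) : term :=
  foldr mul_term unit_term [seq tile_state (tile_of x) (x \in U) | x <- s].

Lemma eq_state_term s (U U' : {set crossing K}) :
  {in s, U =i U'} -> state_term s U = state_term s U'.
Proof.
by move=> UU; congr foldr; apply/eq_in_map => x xs /=; rewrite UU.
Qed.

Definition classical_in (s : seq (crossing K)) : {set crossing K} :=
  [set x in s | kind x != None].

(** By induction on the crossings: the states of x :: s are those of s with or
    without x in U, which are the two terms of the tile of x. *)
Lemma sum_state_terms (V : nmodType) (H : term -> V) s : uniq s ->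
  \sum_(U : {set crossing K} | U \subset classical_in s) H (state_term s U) =
  \sum_(t <- expand [seq tile_of x | x <- s]) H t.
Proof.
elim: s H => [|x s IH] H.
  move=> _; rewrite big_seq1 (big_pred1 set0) // => U.
  have -> : classical_in [::] = set0 by apply/setP => x; rewrite !inE.
  exact: subset0.
move=> /= /andP[xs us]; rewrite big_allpairs_dep.
have xS : x \notin classical_in s by rewrite inE (negPf xs).
have out (U : {set crossing K}) : U \subset classical_in s -> x \notin U.
  by move=> /subsetP US; apply: contra xS; apply: US.
have step_out : \sum_(U : {set crossing K} | U \subset classical_in s) H (state_term (x :: s) U) =
    \sum_(t <- expand [seq tile_of x | x <- s]) H (mul_term (tile_state (tile_of x) false) t).
  by rewrite -IH //; apply: eq_bigr => U /out /negPf; rewrite /state_term /= => ->.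
rewrite /tile_terms -[(tile_of x).1]/(kind x); case E : (kind x) => [e|]; last first.
  rewrite big_seq1 -step_out; apply: eq_bigl => U.
  suff -> : classical_in (x :: s) = classical_in s by [].
  by apply/setP => y; rewrite !inE; case: eqP => //= ->; rewrite E eqxx andbF.
have -> : classical_in (x :: s) = x |: classical_in s.
  by apply/setP => y; rewrite !inE andb_orl; case: eqP => //= ->; rewrite E.
rewrite sum_subsets_setU1 // big_cons big_seq1 step_out; congr (_ + _).
rewrite -IH //; apply: eq_bigr => U US.
rewrite /state_term /= setU11 -/(state_term s (x |: U)) (@eq_state_term _ _ U) //.
by move=> y ys; rewrite !inE; case: eqP => // yx; rewrite -yx ys in xs.
Qed.

Lemma state_term_in s (U : {set crossing K}) :
  (forall x, x \in U -> kind x != None) ->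
  state_term s U \in expand [seq tile_of x | x <- s].
Proof.
move=> Uk; elim: s => [|x s IH] /=; first by rewrite inE.
apply/allpairsP; exists (tile_state (tile_of x) (x \in U), state_term s U); split=> //=.
rewrite /tile_terms /=; case E: (kind x) (Uk x) => [e|].
  by rewrite !inE; case: (x \in U); rewrite eqxx ?orbT.
by case: (x \in U) => [/(_ isT)//|_]; rewrite inE.
Qed.

Lemma state_term_coef s (U : {set crossing K}) :
  coef (state_term s U).1 = \prod_(x <- s) coef (tile_state (tile_of x) (x \in U)).1.
Proof.
elim: s => [|x s IH]; first by rewrite big_nil /coef mulr1.
by rewrite big_cons -IH -coefM.
Qed.

Lemma state_term_arcs s (U : {set crossing K}) :
  (state_term s U).2 = flatten [seq (tile_state (tile_of x) (x \in U)).2 | x <- s].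
Proof. by elim: s => //= x s ->. Qed.

Lemma Apow_sum (I : Type) (r : seq I) (z : I -> int) :
  Apow (\sum_(i <- r) z i) = \prod_(i <- r) Apow (z i).
Proof.
elim: r => [|i r IH]; first by rewrite !big_nil.
by rewrite !big_cons ApowD IH.
Qed.

(** The writhe is a sum over the crossings, so the normalization factor is
    distributed to the tiles. *)
Lemma state_weight_coef s (U : {set crossing K}) :
  perm_eq s (enum (crossing K)) ->
  U \subset classical K ->
  Apow (- 8 * writhe K) * state_weight U = coef (state_term s U).1.
Proof.
move=> sE US; rewrite state_term_coef (perm_big _ sE) /= big_enum /=.
rewrite /writhe mulr_sumr Apow_sum /state_weight [X in _ * X]big_mkcond -big_split /=.
apply: eq_bigr => x _; rewrite inE.
have := subsetP US x; rewrite inE /sign; case: (kind x) => [e|]; last first.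
  by case: (x \in U) => [/(_ isT)//|_]; rewrite /coef !mulr1 mulr0.
case: (x \in U) => _; case: e; rewrite /coef ?expr1 ?expr0 ?mulN1r ?mul1r ?mulrN -?ApowD //.
Qed.
End Bracket.

(** * The graph of a state *)

Lemma perm_flatten_map2 (S : Type) (T : eqType) (g h : S -> seq T) s :
  perm_eq (flatten [seq g x ++ h x | x <- s]) (flatten (map g s) ++ flatten (map h s)).
Proof.
elim: s => //= x s IH.
by rewrite -!catA perm_cat2l perm_sym perm_catCA perm_cat2l perm_sym.
Qed.

Lemma perm_flatten_map (S : Type) (T : eqType) (g h : S -> seq T) s :
  (forall x, perm_eq (g x) (h x)) -> perm_eq (flatten (map g s)) (flatten (map h s)).
Proof.
by move=> gh; elim: s => //= x s IH; apply: perm_cat.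
Qed.

Lemma perm_swap23 (T : eqType) (x y z : T) s : perm_eq [:: x, y, z & s] [:: x, z, y & s].
Proof. by rewrite perm_cons; apply: permEl (perm_catCA [:: y] [:: z] s). Qed.

Lemma flatten_if (S T : Type) (P : pred S) (g : S -> T) s :
  flatten [seq if P x then [:: g x] else [::] | x <- s] = [seq g x | x <- s & P x].
Proof. by elim: s => //= x s ->; case: (P x). Qed.

Section Chains.
Variables (f : digraph -> graph_poly) (fP : graph_evaluation f).

(** Each edge of a diagram is cut at two ports; this contracts the ports of all
    the edges. *)
Lemma evaluate_chains (I : Type) (s : seq I) (p q r t : I -> node_name) E :
  let long := flatten [seq [:: (p i, q i); (q i, r i); (r i, t i)] | i <- s] in
  let short := [seq (p i, t i) | i <- s] in
  web_list (long ++ E) ->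
  web_list (short ++ E) /\ evaluate f (long ++ E) = evaluate f (short ++ E).
Proof.
elim: s E => [|i s IH] E //= w.
have [w1 e1] := evaluate_contract fP w.
have [w2 e2] := evaluate_contract fP w1.
have move_in L : perm_eq ((p i, t i) :: L ++ E) (L ++ (p i, t i) :: E).
  exact: permEl (perm_catCA [:: (p i, t i)] L E).
have [w3 e3] := IH ((p i, t i) :: E) (web_list_perm (move_in _) w2).
have back : perm_eq ([seq (p i, t i) | i <- s] ++ (p i, t i) :: E)
                    ((p i, t i) :: [seq (p i, t i) | i <- s] ++ E).
  by rewrite perm_sym; apply: move_in.
split; first exact: web_list_perm back w3.
by rewrite e1 e2 (evaluate_perm fP (move_in _) w2) e3 (evaluate_perm fP back w3).
Qed.
End Chains.

Section StateGraph.
Variables (f : digraph -> graph_poly) (fP : graph_evaluation f).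
Variables (K : diagram) (c : point K -> nat).
Hypotheses (cI : injective c) (succI : injective (@succ K)) (strandI : injective (@strand K)).

Definition edge_arcs : arc_list := [seq (outp (c p), inp (c (succ p))) | p : point K].

Definition free_points : seq (point K) := [seq p <- enum (point K) | crossing_at p == None].

Lemma crossing_at_strand v : crossing_at (strand v) = Some v :> option (crossing K * bool).
Proof.
rewrite /crossing_at; case: pickP => [w /eqP /strandI -> //|/(_ v)].
by rewrite eqxx.
Qed.

Lemma crossing_atP (p : point K) :
  (exists2 v, p = strand v & crossing_at p = Some v) \/ crossing_at p = None.
Proof.
rewrite /crossing_at; case: pickP => [v /eqP <-|]; [left; exists v => // | by right].
Qed.

Lemma perm_points (s : seq (crossing K)) :
  perm_eq s (enum (crossing K)) ->
  perm_eq (enum (point K))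
    ([seq strand (x, true) | x <- s] ++ [seq strand (x, false) | x <- s] ++ free_points).
Proof.
move=> sE; have us : uniq s by rewrite (perm_uniq sE) enum_uniq.
have sT x : x \in s by rewrite (perm_mem sE) mem_enum.
have mI i : injective (fun x => strand (x, i) : point K) by move=> x y /strandI [].
have nfree v : strand v \notin free_points.
  by rewrite mem_filter crossing_at_strand.
apply: uniq_perm; first exact: enum_uniq.
  rewrite !cat_uniq !map_inj_uniq // us (filter_uniq _ (enum_uniq _)) /= andbT.
  rewrite has_cat negb_or -andbA.
  apply/and3P; split.
  - by apply/hasPn => _ /mapP[x _ ->]; apply/mapP => -[y _ /strandI].
  - by apply/hasPn => p pF /=; apply/mapP => -[x _ E]; rewrite E (negPf (nfree _)) in pF.
  - by apply/hasPn => p pF /=; apply/mapP => -[x _ E]; rewrite E (negPf (nfree _)) in pF.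
move=> p; rewrite mem_enum !mem_cat; apply/esym.
have [[[x i] -> _]|pN] := crossing_atP p.
  have mem_strand : strand (x, i) \in [seq strand (y, i) | y <- s] by apply/mapP; exists x.
  by case: i mem_strand => ->; rewrite ?orbT.
by rewrite mem_filter pN mem_enum !orbT.
Qed.

(** The arcs between the two ports of p and the vertices that replace p in the
    state U. *)
Definition port_arcs (U : {set crossing K}) (p : point K) : arc_list :=
  [:: (inp (c p), mid (c (in_end U p))); (mid (c (out_end U p)), outp (c p))].

Definition new_arcs (U : {set crossing K}) (x : crossing K) : arc_list :=
  if x \in U then [:: (mid (c (strand (x, true))), mid (c (strand (x, false))))] else [::].

(** The arcs of a tile, described crossing by crossing, are those of the state
    graph, described point by point. *)
Lemma tile_state_arcs (U : {set crossing K}) x :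
  (x \in U -> kind x != None) ->
  perm_eq (tile_state (tile_of c x) (x \in U)).2
    (port_arcs U (strand (x, true)) ++ port_arcs U (strand (x, false)) ++ new_arcs U x).
Proof.
move=> Uk; rewrite /port_arcs /new_arcs /in_end /out_end !crossing_at_strand.
rewrite /tile_of /classical inE.
case E: (kind x) Uk => [e|] Uk /=; case xU: (x \in U) Uk => Uk /=; rewrite ?(xU, E) //=.
- exact: perm_swap23.
- exact: perm_swap23.
- by have := Uk isT.
Qed.

Lemma straight_arcs (U : {set crossing K}) p :
  crossing_at p = None -> straight (c p) = port_arcs U p.
Proof. by move=> pN; rewrite /port_arcs /in_end /out_end pN. Qed.

Definition strand_arcs (U : {set crossing K}) : arc_list :=
  [seq (mid (c (out_end U p)), mid (c (in_end U (succ p)))) | p : point K].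

Lemma state_graph_arcs (U : {set crossing K}) s :
  perm_eq s (enum (crossing K)) ->
  perm_eq (arcs_of (G := state_graph U) (fun p => mid (c p)))
    (strand_arcs U ++ flatten [seq new_arcs U x | x <- s]).
Proof.
move=> sE.
pose t : seq (point K + {x : crossing K | x \in U}) :=
  map inl (enum (point K)) ++ map inr (enum {: {x : crossing K | x \in U}}).
apply: perm_trans (@arcs_of_enum (state_graph U) _ t _ _) _.
- rewrite cat_uniq; apply/and3P; split.
  + by rewrite map_inj_uniq ?enum_uniq // => p q [].
  + by apply/hasPn => _ /mapP[x _ ->]; apply/mapP => -[].
  + by rewrite map_inj_uniq ?enum_uniq // => x y [].
- by case=> a; rewrite mem_cat ?(map_f inl) ?(map_f inr) ?orbT // mem_enum.
rewrite map_cat -(map_comp _ inl) -(map_comp _ inr). apply: perm_cat; first exact: perm_refl.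
rewrite flatten_if; pose g x := (mid (c (strand (x, true))), mid (c (strand (x, false)))).
rewrite -[X in perm_eq X _]/(map (g \o val) _) map_comp; apply: perm_map.
apply: uniq_perm.
- by rewrite map_inj_uniq ?enum_uniq //; apply: val_inj.
- by rewrite filter_uniq // (perm_uniq sE) enum_uniq.
move=> x; rewrite mem_filter (perm_mem sE) mem_enum andbT.
apply/mapP/idP => [[y _ ->]|xU]; first exact: (valP y).
by exists (Sub x xU); rewrite ?mem_enum ?SubK.
Qed.

Lemma state_graph_presents (U : {set crossing K}) s :
  perm_eq s (enum (crossing K)) ->
  presents (G := state_graph U) (fun p => mid (c p))
    (strand_arcs U ++ flatten [seq new_arcs U x | x <- s]).
Proof.
move=> sE; have GE := state_graph_arcs U sE.
split=> [p q [/cI]|//|p] //; rewrite -(nodes_perm GE).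
have arcs (q : point K) : (mid (c (out_end U q)), mid (c (in_end U (succ q)))) \in
    arcs_of (G := state_graph U) (fun p => mid (c p)).
  by apply/mapP; exists (inl q); rewrite ?mem_enum.
have [<-|<-] : out_end U p = p \/ in_end U p = p.
- rewrite /out_end /in_end.
  by have [[[x [|]] -> ->]|->] := crossing_atP p; try case: (x \in U); auto.
- by rewrite mem_cat (map_f fst (arcs p)).
rewrite -[X in in_end U X](f_finv succI p) mem_cat (map_f snd (arcs (finv (@succ K) p))).
by rewrite orbT.
Qed.

(** Regrouped point by point, the arcs of the tiles and the edges of the diagram
    form paths of three arcs: from the vertex where an edge leaves p to its
    outgoing port, along the edge to the incoming port of the next point, and
    on to the vertex there.  Contracting the ports leaves the state graph. *)
Lemma evaluate_state_graph (U : {set crossing K}) s C :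
  perm_eq s (enum (crossing K)) ->
  (forall x, x \in U -> kind x != None) ->
  perm_eq C (pass (map c free_points) ++ edge_arcs) ->
  web_list ((state_term c s U).2 ++ C) ->
  f (state_graph U) = evaluate f ((state_term c s U).2 ++ C).
Proof.
move=> sE Uk CE wU.
set news := flatten [seq new_arcs U x | x <- s].
set long := flatten [seq [:: (mid (c (out_end U p)), outp (c p));
   (outp (c p), inp (c (succ p)));
   (inp (c (succ p)), mid (c (in_end U (succ p))))] | p <- enum (point K)].
have E : perm_eq ((state_term c s U).2 ++ C) (long ++ news).
  pose ports ps := flatten [seq port_arcs U p | p <- ps].
  pose in_arc p := (inp (c p), mid (c (in_end U p))).
  pose out_arc p := (mid (c (out_end U p)), outp (c p)).
  pose edge_arc p := (outp (c p), inp (c (succ p))).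
  pose ins := map in_arc (enum (point K)); pose outs := map out_arc (enum (point K)).
  have E1 : perm_eq (state_term c s U).2
      (ports [seq strand (x, true) | x <- s] ++ ports [seq strand (x, false) | x <- s] ++ news).
    rewrite state_term_arcs /ports -!map_comp.
    apply: perm_trans (perm_flatten_map s (fun x => tile_state_arcs (@Uk x))) _.
    apply: perm_trans (perm_flatten_map2 _ _ _) _; rewrite perm_cat2l.
    exact: perm_flatten_map2.
  have E2 : pass (map c free_points) = ports free_points.
    rewrite /pass -map_comp; congr flatten; apply/eq_in_map => p.
    by rewrite mem_filter => /andP[/eqP pN _]; apply: straight_arcs.
  have E3 : perm_eq (ports (enum (point K))) (ports
      ([seq strand (x, true) | x <- s] ++ [seq strand (x, false) | x <- s] ++ free_points)).
    exact/perm_flatten/perm_map/perm_points.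
  have E4 : perm_eq (ports (enum (point K))) (ins ++ outs).
    have := perm_flatten_map2 (fun p => [:: in_arc p]) (fun p => [:: out_arc p]).
    by move/(_ (enum (point K))); rewrite !flatten_map1.
  have E5 : perm_eq long (outs ++ edge_arcs ++ map in_arc (map (@succ K) (enum (point K)))).
    apply: perm_trans (perm_flatten_map2 (fun p => [:: out_arc p])
      (fun p => [:: edge_arc p; in_arc (succ p)]) _) _.
    rewrite flatten_map1 perm_cat2l.
    apply: perm_trans (perm_flatten_map2 (fun p => [:: edge_arc p])
      (fun p => [:: in_arc (succ p)]) _) _.
    by rewrite !flatten_map1 -(map_comp in_arc (@succ K)).
  have E6 : perm_eq (map in_arc (map (@succ K) (enum (point K)))) ins.
    apply/perm_map/uniq_perm; [|exact: enum_uniq|].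
      by rewrite map_inj_uniq ?enum_uniq.
    move=> p; rewrite mem_enum; apply/mapP; exists (finv (@succ K) p); rewrite ?mem_enum //.
    by rewrite f_finv.
  have ports_cat ps qs : ports (ps ++ qs) = ports ps ++ ports qs.
    by rewrite /ports map_cat flatten_cat.
  apply/seq.permP => a; rewrite E2 !ports_cat in CE E3.
  have := seq.permP E1 a; have := seq.permP E3 a; have := seq.permP E4 a.
  have := seq.permP E5 a; have := seq.permP E6 a; have := seq.permP CE a.
  rewrite !count_cat; lia.
have wl := web_list_perm E wU.
have [ws es] := evaluate_chains fP wl.
rewrite (evaluate_perm fP E wU) es.
exact (presents_evaluate fP (state_graph_presents U sE) ws).
Qed.
End StateGraph.

(** * Replacing a tangle inside a diagram *)

Lemma tangle_avoids ps S i : tangle ps S -> i \notin ps -> mid i \notin nodes S.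
Proof.
move=> hS ips; have [_ _ _ _ [_ /(_ ips) [i0 o0]]] := hS i.
by rewrite mem_cat -in_countP -out_countP i0 o0.
Qed.

Lemma nodes_cat (S T : arc_list) v :
  (v \in nodes (S ++ T)) = (v \in nodes S) || (v \in nodes T).
Proof.
by rewrite !mem_cat -!in_countP -!out_countP in_count_cat out_count_cat !addn_gt0 orbACA.
Qed.

Lemma perm_cat_subset (T : eqType) (A B : seq T) :
  uniq A -> uniq B -> {subset A <= B} ->
  perm_eq B (A ++ [seq x <- B | x \notin A]).
Proof.
move=> uA uB AB; apply: uniq_perm => //.
  rewrite cat_uniq uA filter_uniq // andbT; apply/hasPn => x.
  by rewrite mem_filter => /andP[].
move=> x; rewrite mem_cat mem_filter.
by have := AB x; case: (x \in A) => // ->.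
Qed.

Definition ends (L : diagram) (s : seq (crossing L)) : seq (point L) :=
  [seq strand (x, true) | x <- s] ++ [seq strand (x, false) | x <- s].

Lemma tile_points_ends (L : diagram) (d : point L -> nat) (s : seq (crossing L)) :
  perm_eq (flatten (map tile_points [seq tile_of d x | x <- s])) (map d (ends s)).
Proof.
rewrite /ends -map_comp map_cat -!map_comp.
apply: perm_trans (perm_flatten_map2 (fun x => [:: d (strand (x, true))])
  (fun x => [:: d (strand (x, false))]) s) _.
by rewrite !flatten_map1.
Qed.

Lemma perm_points_cat (L : diagram) (s t : seq (crossing L)) :
  injective (@strand L) -> perm_eq (s ++ t) (enum (crossing L)) ->
  perm_eq (enum (point L)) (ends s ++ ends t ++ free_points L).
Proof.
move=> tI /(perm_points tI) E; rewrite (permPl E) /ends !map_cat -!catA perm_cat2l.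
exact: permEl (perm_catCA _ _ _).
Qed.

Lemma perm_cancel (T : eqType) (A A' B F F' M : seq T) :
  perm_eq (A' ++ M) A -> perm_eq (A ++ B ++ F) (A' ++ B ++ F') -> perm_eq F' (M ++ F).
Proof.
move=> AM AF; apply/seq.permP => a.
have := seq.permP AM a; have := seq.permP AF a; rewrite !count_cat; lia.
Qed.

Section Value.
Variables (f : digraph -> graph_poly) (fP : graph_evaluation f).

Lemma value_perm C C' ts :
  perm_eq C C' -> webs C ts -> value f C ts = value f C' ts.
Proof.
move=> CC wts; apply: eq_big_seq => t /wts wt.
have E : perm_eq (t.2 ++ C) (t.2 ++ C') by rewrite perm_cat2l.
by rewrite /term_value (evaluate_perm fP E wt).
Qed.

Lemma webs_perm C C' ts : perm_eq C C' -> webs C ts -> webs C' ts.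
Proof.
by move=> CC wts t /wts; apply: web_list_perm; rewrite perm_cat2l.
Qed.

Section Diagram.
Variables (K : diagram) (c : point K -> nat).
Hypotheses (cI : injective c) (succI : injective (@succ K)) (strandI : injective (@strand K)).

Definition context : arc_list := pass (map c (free_points K)) ++ edge_arcs c.

(** The tiles and the free points form a tangle with ports at all points, and
    the edges of the diagram close it. *)
Lemma webs_tiles s :
  perm_eq s (enum (crossing K)) -> webs context (expand [seq tile_of c x | x <- s]).
Proof.
move=> sE t tE; rewrite /context catA.
set xs := [seq tile_of c x | x <- s] in tE *.
have E1 : perm_eq (flatten (map tile_points xs))
    (map c ([seq strand (x, true) | x <- s] ++ [seq strand (x, false) | x <- s])).
  exact: tile_points_ends.
have E2 : perm_eq (flatten (map tile_points xs) ++ map c (free_points K))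
    (map c (enum (point K))).
  rewrite (permPr (perm_map c (perm_points strandI sE))) catA map_cat perm_cat2r.
  exact: E1.
have uE : uniq (flatten (map tile_points xs) ++ map c (free_points K)).
  by rewrite (perm_uniq E2) map_inj_uniq ?enum_uniq.
have := uE; rewrite cat_uniq => /and3P[u1 u12 u2].
have h := tangle_cat u12 (tangle_expand u1 tE) (tangle_pass u2).
apply: (tangle_close uE h).
  rewrite (permPr (perm_map outp E2)) /edge_arcs /unzip1 -!map_comp; exact: perm_refl.
have succE : perm_eq (map (@succ K) (enum (point K))) (enum (point K)).
  apply: uniq_perm; [by rewrite map_inj_uniq ?enum_uniq | exact: enum_uniq |].
  move=> p; rewrite mem_enum; apply/mapP; exists (finv (@succ K) p); rewrite ?mem_enum //.
  by rewrite f_finv.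
rewrite (permPr (perm_map inp E2)).
have -> : unzip2 (edge_arcs c) = map inp (map c (map (@succ K) (enum (point K)))).
  by rewrite /unzip2 -(map_comp snd) -(map_comp c) -(map_comp inp).
exact/perm_map/perm_map.
Qed.

(** This replaces diagrams by lists of tiles.  The coding c of the points and
    the order s of the crossings are arbitrary, and will be chosen so that the
    part changed by a move comes first. *)
Lemma normalized_bracket_value s :
  perm_eq s (enum (crossing K)) ->
  normalized_bracket K f = value f context (expand [seq tile_of c x | x <- s]).
Proof.
move=> sE; have us : uniq s by rewrite (perm_uniq sE) enum_uniq.
rewrite /value -sum_state_terms // /normalized_bracket /bracket mulr_sumr.
have -> : classical_in s = classical K.
  by apply/setP => x; rewrite !inE (perm_mem sE) mem_enum.
apply: eq_bigr => U UK.
rewrite !mul_malgC scalerA (state_weight_coef c sE UK) /term_value; congr (_ *: _).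
have Uk x : x \in U -> kind x != None by move/(subsetP UK); rewrite inE.
apply: (evaluate_state_graph fP) => //.
have tE := state_term_in c s Uk.
exact: webs_tiles sE _ tE.
Qed.
End Diagram.

Definition inner_arcs (I : seq (nat * nat)) : arc_list :=
  [seq (outp ij.1, inp ij.2) | ij <- I].

Definition attach (E : arc_list) (ts : seq term) : seq term :=
  [seq (t.1, t.2 ++ E) | t <- ts].

(** The two sides of a local move on the points 0, ..., k - 1: the tiles ts are
    replaced by us, the points ps become free, and the edges from i to j for
    (i, j) in I lie inside the tangle.  Every point must be used exactly once
    on each side. *)
Definition local_check k (I : seq (nat * nat)) (ts us : seq tile) (ps : seq nat) : bool :=
  [&& perm_eq (flatten (map tile_points ts)) (iota 0 k),
      perm_eq (flatten (map tile_points us) ++ ps) (iota 0 k),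
      uniq I, all (fun ij => (ij.1 < k) && (ij.2 < k))%N I &
      same_value k (attach (inner_arcs I) (expand ts))
                   (attach (pass ps ++ inner_arcs I) (expand us))].

Lemma value_expand_cat C ts rest :
  value f C (expand (ts ++ rest)) =
  \sum_(r <- expand rest) \sum_(s <- expand ts) term_value f C (mul_term s r).
Proof. by rewrite /value expand_cat exchange_big. Qed.

Lemma value_attach C C' L r ts :
  perm_eq C (L ++ C') ->
  (forall s, s \in ts -> web_list ((mul_term s r).2 ++ C)) ->
  webs (r.2 ++ C') (attach L ts) /\
  \sum_(s <- ts) term_value f C (mul_term s r) =
    coef r.1 *: value f (r.2 ++ C') (attach L ts).
Proof.
move=> CE w.
have E s : perm_eq ((mul_term s r).2 ++ C) ((s.2 ++ L) ++ (r.2 ++ C')).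
  rewrite /= -!catA perm_cat2l perm_sym perm_catCA perm_cat2l.
  by rewrite perm_sym; exact: CE.
split; first by move=> _ /mapP[s sts ->]; apply: web_list_perm (E s) (w s sts).
rewrite /value big_map scaler_sumr; apply: eq_big_seq => s sts.
rewrite /term_value coefM mulrC -scalerA (evaluate_perm fP (E s) (w s sts)) //.
Qed.

(** The terms are grouped by the state r of the crossings outside the tangle.
    For each r the two sides are combinations of tangles in one context, and
    the local check compares these. *)
Lemma local_replacement k I ts us rest ps qs E :
  local_check k I ts us ps ->
  uniq (flatten (map tile_points rest)) -> uniq qs ->
  {in flatten (map tile_points rest), forall p, k <= p}%N ->
  {in qs, forall p, k <= p}%N ->
  (forall p, mid p \notin nodes E) ->
  let C := pass qs ++ inner_arcs I ++ E in
  webs C (expand (ts ++ rest)) -> webs (pass ps ++ C) (expand (us ++ rest)) ->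
  value f C (expand (ts ++ rest)) = value f (pass ps ++ C) (expand (us ++ rest)).
Proof.
case/and5P => _ _ _ _ chk urest uqs restk qsk Emid C wt wu.
rewrite !value_expand_cat; apply: eq_big_seq => r rE.
have wtr s : s \in expand ts -> web_list ((mul_term s r).2 ++ C).
  by move=> sE; apply: wt; apply: mem_expand_cat.
have wur s : s \in expand us -> web_list ((mul_term s r).2 ++ (pass ps ++ C)).
  by move=> sE; apply: wu; apply: mem_expand_cat.
have [|wt' ->] := value_attach (C' := pass qs ++ E) (L := inner_arcs I) _ wtr.
  by rewrite /C perm_catCA.
have [|wu' ->] := value_attach (C' := pass qs ++ E) (L := pass ps ++ inner_arcs I) _ wur.
  by rewrite /C -catA perm_cat2l perm_catCA.
congr (_ *: _); apply: (same_value_sound fP) chk => //.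
move=> i ik; rewrite !nodes_cat !negb_or Emid andbT; apply/andP; split.
  apply: tangle_avoids (tangle_expand urest rE) _.
  by apply: contraL ik => /restk; rewrite -leqNgt.
apply: tangle_avoids (tangle_pass uqs) _.
by apply: contraL ik => /qsk; rewrite -leqNgt.
Qed.

Section DiagramMove.
Variables (K : diagram) (X' : finType) (kd : X' -> option bool).
Variables (st : X' * bool -> point K) (p0 : point K) (pts : seq (point K)).
Variables (D : seq (crossing K)) (D' R' : seq X') (h : X' -> crossing K).
Variables (ts us : seq tile) (ps : seq nat) (I : seq (nat * nat)).

Let K' := @Diagram (point K) (@succ K) X' kd st.

Definition place (t : tile) : option bool * (point K * point K) :=
  (t.1, (nth p0 pts t.2.1, nth p0 pts t.2.2)).

Definition crossing_data (L : diagram) (x : crossing L) :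
    option bool * (point L * point L) :=
  (kind x, (strand (x, true), strand (x, false))).

Hypotheses (Kwf : well_formed K) (K'wf : well_formed K').
Hypothesis chk : local_check (size pts) I ts us ps.
Hypothesis upts : uniq pts.
Hypothesis DE : perm_eq (D ++ map h R') (enum (crossing K)).
Hypothesis D'E : perm_eq (D' ++ R') (enum X').
Hypothesis hE : {in R', forall x, kd x = kind (h x) /\ forall i, st (x, i) = strand (h x, i)}.
Hypothesis tsE : map (@crossing_data K) D = map place ts.
Hypothesis usE : map (@crossing_data K') D' = map place us.
Hypothesis IE : all (fun ij => succ (nth p0 pts ij.1) == nth p0 pts ij.2) I.

Let c (p : point K) : nat := index p (pts ++ enum (point K)).

Fact code_inj : injective c.
Proof.
move=> p q pq; have mem r : r \in pts ++ enum (point K) by rewrite mem_cat mem_enum orbT.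
by rewrite -(nth_index p (mem p)) -/(c p) pq nth_index.
Qed.

Fact code_nth i : (i < size pts)%N -> c (nth p0 pts i) = i.
Proof. by move=> ik; rewrite /c index_cat mem_nth // index_uniq. Qed.

Fact code_outside p : p \notin pts -> (size pts <= c p)%N.
Proof. by move=> pN; rewrite /c index_cat (negPf pN) leq_addr. Qed.

Fact nth_pts : map (nth p0 pts) (iota 0 (size pts)) = pts.
Proof. exact: mkseq_nth. Qed.

(** Stated for an arbitrary diagram because it serves both sides of a move. *)
Fact ends_placed (L : diagram) (s : seq (crossing L)) (g : nat -> point L) vs :
  map (@crossing_data L) s = [seq (t.1, (g t.2.1, g t.2.2)) | t <- vs] ->
  perm_eq (ends s) (map g (flatten (map tile_points vs))).
Proof.
rewrite /ends; elim: s vs => [|x s IH] [|v vs] //= [_ -> -> /IH sE].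
rewrite perm_cons -cat1s perm_catCA perm_cons //.
Qed.

Fact code_placed (L : diagram) (d : point L -> nat) (g : nat -> point L)
    (s : seq (crossing L)) vs :
  {in flatten (map tile_points vs), cancel g d} ->
  map (@crossing_data L) s = [seq (t.1, (g t.2.1, g t.2.2)) | t <- vs] ->
  [seq tile_of d x | x <- s] = vs.
Proof.
elim: s vs => [|x s IH] [|[e [i j]] vs] //= gK [ke ti tj sE].
rewrite /tile_of ke ti tj !gK ?inE ?eqxx ?orbT // (IH vs) // => r rvs.
by apply: gK; rewrite !inE rvs !orbT.
Qed.

(** D and D' are the crossings of the two diagrams inside the tangle, R' those of
    K' outside it, which h matches with the remaining crossings of K.
    The local points are coded by their positions in pts and the others by
    larger numbers.  The free points of K' are then those of K together with
    the local points that no longer carry a crossing, and all other tiles and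
    edges agree. *)
Lemma diagram_move : normalized_bracket K f = normalized_bracket K' f.
Proof.
have [sI tI _] := Kwf; have [_ tI' _] := K'wf.
have /and5P[tsP usP uI Ik _] := chk.
rewrite (normalized_bracket_value code_inj sI tI DE).
rewrite (normalized_bracket_value (K := K') code_inj sI tI' D'E).
have bound s : perm_eq s (iota 0 (size pts)) -> {in s, cancel (nth p0 pts) c}.
  by move=> sP i; rewrite (perm_mem sP) mem_iota => /andP[_]; apply: code_nth.
have tsC : [seq tile_of c x | x <- D] = ts by apply: code_placed tsE; apply: bound.
have usC : [seq tile_of (K := K') c x | x <- D'] = us.
  apply: code_placed usE => i ius; apply: (bound _ usP); by rewrite mem_cat ius.
set rest := [seq tile_of c x | x <- map h R'].
have restC : [seq tile_of (K := K') c x | x <- R'] = rest.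
  rewrite /rest -map_comp; apply/eq_in_map => x /hE[kx sx].
  by rewrite /tile_of /= kx !sx.
rewrite !map_cat tsC usC restC -/rest.
have endsD : perm_eq (ends D) pts.
  rewrite -[X in perm_eq _ X]nth_pts (permPl (ends_placed tsE)).
  exact: perm_map tsP.
have endsD' : perm_eq (ends (L := K') D' ++ map (nth p0 pts) ps) pts.
  rewrite -[X in perm_eq _ X]nth_pts -(permPr (perm_map _ usP)) map_cat perm_cat2r.
  exact: ends_placed usE.
have endsR : ends (L := K') R' = ends (map h R').
  by rewrite /ends -!map_comp; congr (_ ++ _); apply/eq_in_map => x /hE[_ sx] /=; rewrite sx.
have pointsE := perm_points_cat tI DE.
have freeE : perm_eq (free_points K') (map (nth p0 pts) ps ++ free_points K).
  have := perm_points_cat (L := K') tI' D'E.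
  rewrite endsR -[enum (point K')]/(enum (point K)) (permPl pointsE).
  apply: perm_cancel; rewrite (permPr endsD); exact: endsD'.
have := enum_uniq (point K); rewrite (perm_uniq pointsE) cat_uniq => /and3P[_ outR' usR].
have outR : {in ends (map h R') ++ free_points K, forall p, p \notin pts}.
  by move=> p pR; rewrite -(perm_mem endsD); apply: (hasPn outR').
have [E' EE E'm] : exists2 E', perm_eq (edge_arcs (K := K) c) (inner_arcs I ++ E') &
    forall p, mid p \notin nodes E'.
  exists [seq e <- edge_arcs (K := K) c | e \notin inner_arcs I].
    apply: perm_cat_subset.
    - by rewrite map_inj_uniq // => -[i j] [i' j'] [-> ->].
    - by rewrite map_inj_uniq ?enum_uniq // => p q [/code_inj].
    - move=> _ /mapP[[i j] ijI ->] /=; have /andP[/= ik jk] := allP Ik _ ijI.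
      apply/mapP; exists (nth p0 pts i); rewrite ?mem_enum //.
      by rewrite (eqP (allP IE _ ijI)) !code_nth.
  move=> p; rewrite mem_cat; apply/norP.
  by split; apply/mapP => -[e]; rewrite mem_filter => /andP[_ /mapP[q _ ->]].
have CE : perm_eq (context c) (pass (map c (free_points K)) ++ inner_arcs I ++ E').
  by rewrite perm_cat2l.
have C'E : perm_eq (context (K := K') c)
    (pass ps ++ pass (map c (free_points K)) ++ inner_arcs I ++ E').
  rewrite /context catA; apply: perm_cat; last exact: EE.
  apply: perm_trans (perm_flatten (perm_map _ (perm_map c freeE))) _.
  rewrite map_cat -map_comp map_cat flatten_cat perm_cat2r /pass.
  suff -> : map (c \o nth p0 pts) ps = ps by [].
  rewrite -[RHS]map_id; apply/eq_in_map => i ips; apply: (bound _ usP).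
  by rewrite mem_cat ips orbT.
have wK := webs_tiles code_inj sI tI DE.
have wK' := webs_tiles (K := K') code_inj sI tI' D'E.
rewrite !map_cat tsC -/rest in wK; rewrite !map_cat usC restC in wK'.
rewrite (value_perm CE wK) (value_perm C'E wK').
have restP := tile_points_ends c (map h R').
apply: local_replacement chk _ _ _ _ E'm _ _.
- rewrite (perm_uniq restP) map_inj_uniq; last exact: code_inj.
  by have := usR; rewrite cat_uniq => /and3P[].
- rewrite map_inj_uniq; last exact: code_inj.
  by have := usR; rewrite cat_uniq => /and3P[].
- move=> q; rewrite (perm_mem restP) => /mapP[p pR ->].
  by apply/code_outside/outR; rewrite mem_cat pR.
- by move=> _ /mapP[p pR ->]; apply/code_outside/outR; rewrite mem_cat pR orbT.
- exact: webs_perm CE wK.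
- exact: webs_perm C'E wK'.
Qed.
End DiagramMove.
End Value.

(** * The local identities behind the moves *)

(** An edge between two local points, in the direction of its strand. *)
Definition link (reversed : bool) (i j : nat) : nat * nat :=
  if reversed then (j, i) else (i, j).

Definition ordered (b : bool) (i j : nat) : nat * nat := if b then (i, j) else (j, i).

(** In powers of A: for sign e, the circle and the bigon that appear give
    A^(-6e) (A^6 + 1 + A^(-6)) - A^(-9e) (A^3 + A^(-3)) = 1. *)
Lemma kink_check e i :
  local_check 2 [:: link (~~ i) 0 1] [:: (e, (0, 1)%N)] [::] [:: 0; 1]%N.
Proof. by case: e => [[]|]; case: i; vm_compute. Qed.

(** For parallel strands the three states with an unoriented crossing cancel by
    the bigon relation.  For antiparallel strands the quadrilateral relation
    gives the expected resolution once and the other one with coefficient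
    (A^6 + 1 + A^(-6)) - (A^3 + A^(-3))^2 + 1 = 0. *)
Lemma bigon_check e e' r r' :
  cancelling e e' ->
  local_check 4 [:: link r 1 2; link r' 0 3] [:: (e, (0, 1)); (e', (2, 3))]%N
    [::] [:: 0; 1; 2; 3]%N.
Proof. by case: e e' => [[]|] [[]|] // _; case: r; case: r'; vm_compute. Qed.

(** The crossings of the lines 0 and 1, 0 and 2, 1 and 2.  The pairs (i, j), (k, l)
    and (m, n) give the point on the first and on the second of the two lines. *)
Definition triangle_tiles (o : bool * bool * bool) (e01 e02 e12 : option bool)
    (i j k l m n : nat) : seq tile :=
  let: (o0, o1, o2) := o in
  [:: (e01, ordered (o0 (+) o1) i j); (e02, ordered (o0 (+) o2) k l);
      (e12, ordered (o1 (+) o2) m n)].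

(** The points 0, 1 are those of the crossing of lines 0 and 1, on line 0 and on
    line 1; likewise 2, 3 for lines 0 and 2, and 4, 5 for lines 1 and 2.  On the
    other side of the move each line meets the other two in the opposite
    order, so the two points of each line are exchanged. *)
Definition triangle_check o0 o1 o2 e01 e02 e12 : bool :=
  local_check 6 [:: link o0 0 2; link o1 1 4; link o2 3 5]
    (triangle_tiles (o0, o1, o2) e01 e02 e12 0 1 2 3 4 5)
    (triangle_tiles (o0, o1, o2) e01 e02 e12 2 4 0 5 1 3) [::].

(** The boolean b_ij says that line i is higher than line j.  Of the eight choices
    the hypothesis keeps the six that come from heights of the lines. *)
Lemma classical_triangle_check o0 o1 o2 b01 b02 b12 :
  (b01 && b12 ==> b02) && (b02 ==> b01 || b12) ->
  triangle_check o0 o1 o2 (Some (b01 (+) (o0 (+) o1))) (Some (b02 (+) (o0 (+) o2)))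
    (Some (b12 (+) (o1 (+) o2))).
Proof.
by case: b01; case: b02; case: b12 => // _; case: o0; case: o1; case: o2; vm_compute.
Qed.

Lemma virtual_triangle_check o0 o1 o2 e :
  [&& triangle_check o0 o1 o2 None None e, triangle_check o0 o1 o2 None e None &
      triangle_check o0 o1 o2 e None None].
Proof. by case: e => [[]|]; case: o0; case: o1; case: o2; vm_compute. Qed.

(** The points of the flanking virtual crossings are 0, 1 and 4, 5, those of the
    classical crossing 2, 3; r says that the second strand runs backwards. *)
Definition flank_links (r : bool) : seq (nat * nat) :=
  ([:: (1, 2); (2, 5)] ++ if r then [:: (4, 3); (3, 0)] else [:: (0, 3); (3, 4)])%N.

(** The oriented state and the unoriented one are both unchanged when the two
    incoming and the two outgoing edges of a crossing are exchanged. *)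
Lemma virtualization_check e r :
  local_check 6 (flank_links r)
    [:: (None, (0, 1)); (e, (2, 3)); (None, (4, 5))]%N [:: (e, (3, 2)%N)] [:: 0; 1; 4; 5]%N.
Proof. by case: e => [[]|]; case: r; vm_compute. Qed.

(** * Redrawings *)

Lemma perm_interleave (T : eqType) (a b c d : T) s t :
  perm_eq [:: b, c & s ++ [:: a, d & t]] [:: a, b, c, d & s ++ t].
Proof. by apply/seq.permP => p; rewrite /= !count_cat /=; lia. Qed.

Section Redrawing.
Variables (f : digraph -> graph_poly) (fP : graph_evaluation f).

Lemma isotopy_invariance (K K' : diagram)
    (h : point K -> point K') (g : crossing K -> crossing K') :
  well_formed K -> well_formed K' -> bijective h -> bijective g ->
  (forall p, h (succ p) = succ (h p)) -> (forall x, kind (g x) = kind x) ->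
  (forall x i, strand (g x, i) = h (strand (x, i))) ->
  normalized_bracket K f = normalized_bracket K' f.
Proof.
move=> [sI tI _] [sI' tI' _] hB gB hs gk gt.
pose c' (p : point K') : nat := enum_rank p.
have c'I : injective c' by move=> p q /ord_inj /enum_rank_inj.
have hI := bij_inj hB; have gI := bij_inj gB.
(* With this coding the two diagrams have the same tiles. *)
pose c p := c' (h p); have cI : injective c by apply: inj_comp.
have gE : perm_eq (map g (enum (crossing K))) (enum (crossing K')).
  apply: uniq_perm; [by rewrite map_inj_uniq ?enum_uniq | exact: enum_uniq |].
  move=> x; rewrite mem_enum; case: gB => g' _ g'K; rewrite -[x]g'K map_f ?mem_enum //.
have hE : perm_eq (enum (point K')) (map h (enum (point K))).
  apply: uniq_perm; [exact: enum_uniq | by rewrite map_inj_uniq ?enum_uniq |].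
  move=> p; rewrite mem_enum; case: hB => h' _ h'K; rewrite -[p]h'K map_f ?mem_enum //.
rewrite (normalized_bracket_value fP cI sI tI (perm_refl _)).
rewrite (normalized_bracket_value fP c'I sI' tI' gE).
have -> : [seq tile_of c' x | x <- map g (enum (crossing K))] =
          [seq tile_of c x | x <- enum (crossing K)].
  by rewrite -map_comp; apply: eq_map => x; rewrite /tile_of /= gk !gt.
apply: (value_perm fP) (webs_tiles cI sI tI (perm_refl _)).
have crossing_at_h p : (crossing_at (h p) == None) = (crossing_at p == None).
  have [[[x i] -> ->]|pN] := crossing_atP p; first by rewrite -gt crossing_at_strand.
  rewrite pN; have [[[y i] E _]|->//] := crossing_atP (h p).
  case: gB => g' _ g'K; move: E; rewrite -[y]g'K gt => /hI E.
  by rewrite E crossing_at_strand in pN.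
have freeE : perm_eq (map h (free_points K)) (free_points K').
  rewrite /free_points perm_sym (permPl (perm_filter _ hE)) filter_map.
  by rewrite (eq_filter (a2 := fun p => crossing_at p == None)) // => p; apply: crossing_at_h.
apply: perm_cat.
  apply/perm_flatten/perm_map; rewrite -(permPr (perm_map c' freeE)) -map_comp; exact: perm_refl.
have edgesE : edge_arcs c = [seq (outp (c' q), inp (c' (succ q))) | q <- map h (enum (point K))].
  by rewrite -map_comp; apply: eq_map => p; rewrite /= /c hs.
by rewrite edgesE perm_sym; apply: perm_map.
Qed.

(** A point on no crossing cuts its edge by two ports and a vertex. *)
Lemma value_subdivide a b c d e E ts :
  webs [:: (a, b), (b, c), (c, d), (d, e) & E] ts ->
  value f [:: (a, b), (b, c), (c, d), (d, e) & E] ts = value f ((a, e) :: E) ts.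
Proof.
move=> w; apply: eq_big_seq => t /w wt; rewrite /term_value.
have perm L : perm_eq (t.2 ++ L ++ E) (L ++ t.2 ++ E) by rewrite perm_catCA.
have wt4 := web_list_perm (perm [:: (a, b); (b, c); (c, d); (d, e)]) wt.
have [wt3 e3] := evaluate_contract fP wt4.
have [wt2 e2] := evaluate_contract fP wt3.
have [wt1 e1] := evaluate_contract fP wt2.
have perm1 : perm_eq ((a, e) :: t.2 ++ E) (t.2 ++ (a, e) :: E).
  by rewrite perm_sym; apply: (perm [:: (a, e)]).
rewrite -(evaluate_perm fP perm1 wt1) -e1 -e2 -e3.
by rewrite (evaluate_perm fP (perm [:: (a, b); (b, c); (c, d); (d, e)]) wt).
Qed.

Lemma add_point_invariance (K : diagram) (p : point K) :
  well_formed K -> well_formed (add_point p) ->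
  normalized_bracket K f = normalized_bracket (add_point p) f.
Proof.
set K' := add_point p; move=> [sI tI _] [sI' tI' _].
pose c' (q : point K') : nat := enum_rank q.
have c'I : injective c' by move=> q r /ord_inj /enum_rank_inj.
(* The crossings, and hence the tiles, keep their codes; only None is new. *)
pose c (q : point K) := c' (Some q); have cI : injective c by move=> q r /c'I [].
have EK := perm_refl (enum (crossing K)).
rewrite (normalized_bracket_value fP cI sI tI EK).
rewrite (normalized_bracket_value (K := K') fP c'I sI' tI' EK).
set ts := expand _.
have wK' : webs (context c') ts := webs_tiles (K := K') c'I sI' tI' EK.
have pointsE : perm_eq (enum (point K')) (None :: map Some (enum (point K))).
  apply: uniq_perm; first exact: enum_uniq.
    by rewrite /= map_inj_uniq ?enum_uniq ?andbT; [apply/mapP => -[] | apply: Some_inj].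
  by case=> [q|]; rewrite mem_enum //=; apply/esym/mapP; exists q; rewrite ?mem_enum.
have crossing_at_None : crossing_at (None : point K') = None.
  by have [[v]|] := crossing_atP (None : point K').
have crossing_at_Some q : (crossing_at (Some q : point K') == None) = (crossing_at q == None).
  have [[v -> ->]|qN] := crossing_atP q.
    by rewrite (crossing_at_strand (K := K') tI').
  by rewrite qN; have [[v [E] _]|->//] := crossing_atP (Some q : point K');
    rewrite E crossing_at_strand in qN.
have freeE : perm_eq (free_points K') (None :: map Some (free_points K)).
  rewrite /free_points (permPl (perm_filter _ pointsE)) /= crossing_at_None eqxx.
  rewrite perm_cons filter_map (eq_filter (a2 := fun q => crossing_at q == None)) // => q.
pose edge_at (q : point K) := (outp (c q), inp (c (succ q))).
pose others := map edge_at [seq q <- enum (point K) | q != p].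
have splitE : perm_eq (enum (point K)) (p :: [seq q <- enum (point K) | q != p]).
  have pE : p \in enum (point K) by rewrite mem_enum.
  by rewrite (permPl (perm_to_rem pE)) perm_cons rem_filter ?enum_uniq.
have edgesK : perm_eq (edge_arcs c) (edge_at p :: others) by apply: perm_map splitE.
have edgesK' : perm_eq (edge_arcs c')
    [:: (outp (c p), inp (c' None)), (outp (c' None), inp (c (succ p))) & others].
  apply: perm_trans (perm_map _ pointsE) _; rewrite map_cons.
  rewrite perm_sym; apply: perm_trans (permEl (perm_catCA [:: _] [:: _] others)) _.
  rewrite perm_cons perm_sym.
  rewrite -(map_comp _ Some); apply: perm_trans (perm_map _ splitE) _.
  rewrite /= eqxx perm_cons.
  set s := (X in perm_eq X _); suff -> : s = others by [].
  apply/eq_in_map => q; rewrite mem_filter /edge_at /c /= => /andP[/negPf -> _] //.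
have CE : perm_eq (context c)
    ((outp (c p), inp (c (succ p))) :: pass (map c (free_points K)) ++ others).
  rewrite /context; apply: perm_trans (perm_cat (perm_refl _) edgesK) _.
  exact: permEl (perm_catCA _ [:: _] _).
have C'E : perm_eq (context c') [:: (outp (c p), inp (c' None)), (inp (c' None), mid (c' None)),
    (mid (c' None), outp (c' None)), (outp (c' None), inp (c (succ p))) &
    pass (map c (free_points K)) ++ others].
  apply: perm_trans (perm_cat (perm_flatten (perm_map _ (perm_map c' freeE))) edgesK') _.
  rewrite [perm_eq _ _]/= -(map_comp c' Some) -/(pass _).
  rewrite -[map (c' \o Some) _]/(map c (free_points K)).
  exact: perm_interleave.
rewrite (value_perm fP C'E wK') value_subdivide; last exact: webs_perm C'E wK'.
apply: (value_perm fP) (webs_tiles cI sI tI EK).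
exact: CE.
Qed.
End Redrawing.

(** * Kinks, bigons and virtualization *)

Lemma perm_enum_erase (T : finType) (S : {set T}) :
  perm_eq (enum S ++ map val (enum {: {x : T | x \notin S}})) (enum T).
Proof.
rewrite perm_sym; apply: perm_trans (perm_cat_subset (enum_uniq S) (enum_uniq T) _) _.
  by move=> x _; rewrite mem_enum.
rewrite perm_cat2l; apply: uniq_perm.
- exact/filter_uniq/enum_uniq.
- by rewrite map_inj_uniq ?enum_uniq //; apply: val_inj.
move=> x; rewrite mem_filter !mem_enum andbT.
apply/idP/mapP => [xS|[y _ ->]]; last exact: (valP y).
by exists (Sub x xS); rewrite ?mem_enum ?SubK.
Qed.

Lemma perm_enum_set2 (T : finType) (x y : T) :
  x != y -> perm_eq (enum [set x; y]) [:: x; y].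
Proof.
move=> xy; apply: uniq_perm; rewrite ?enum_uniq //= ?inE ?xy // => z.
by rewrite mem_enum !inE.
Qed.

Section Moves.
Variables (f : digraph -> graph_poly) (fP : graph_evaluation f).

Lemma kink_invariance (K : diagram) (x : crossing K) i :
  well_formed K -> well_formed (erase [set x]) ->
  succ (strand (x, i)) = strand (x, ~~ i) ->
  normalized_bracket K f = normalized_bracket (erase [set x]) f.
Proof.
move=> Kwf K'wf sx; have [_ tI _] := Kwf.
apply: (@diagram_move f fP K {y : crossing K | y \notin [set x]} (fun y => kind (val y))
  (fun v => strand (val v.1, v.2)) (strand (x, true))
  [:: strand (x, true); strand (x, false)] [:: x] [::] (enum _) val
  _ _ _ _ Kwf K'wf (kink_check (kind x) i)) => //.
- by rewrite /= inE (inj_eq tI) xpair_eqE andbF.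
- by rewrite -(enum_set1 x); apply: perm_enum_erase.
- exact: perm_refl.
- by case: i sx => /= ->; rewrite eqxx.
Qed.

Lemma bigon_invariance (K : diagram) (x y : crossing K) (r r' : bool) :
  well_formed K -> well_formed (erase [set x; y]) ->
  x != y -> cancelling (kind x) (kind y) ->
  follows r (strand (x, false)) (strand (y, true)) ->
  follows r' (strand (x, true)) (strand (y, false)) ->
  normalized_bracket K f = normalized_bracket (erase [set x; y]) f.
Proof.
move=> Kwf K'wf xy kxy fr fr'; have [_ tI _] := Kwf.
apply: (@diagram_move f fP K {z : crossing K | z \notin [set x; y]} (fun y => kind (val y))
  (fun v => strand (val v.1, v.2)) (strand (x, true))
  [:: strand (x, true); strand (x, false); strand (y, true); strand (y, false)]
  [:: x; y] [::] (enum _) val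
  _ _ _ _ Kwf K'wf (bigon_check r r' kxy)) => //.
- by rewrite /= !inE !(inj_eq tI) !xpair_eqE !andbF (negPf xy).
- rewrite -(permPr (perm_enum_erase [set x; y])) perm_sym.
  exact: perm_cat (perm_enum_set2 xy) (perm_refl _).
- exact: perm_refl.
- by case: r r' fr fr' => [] [] /= -> ->; rewrite !eqxx.
Qed.

Lemma virtualization_invariance (K : diagram) (x y z : crossing K)
    (xy : y \notin [set x; z]) :
  well_formed K -> well_formed (@swap_strands (erase [set x; z]) (exist _ y xy)) ->
  x != z -> kind x = None -> kind z = None ->
  succ (strand (x, false)) = strand (y, true) ->
  succ (strand (y, true)) = strand (z, false) ->
  (succ (strand (x, true)) = strand (y, false) /\
     succ (strand (y, false)) = strand (z, true)) \/
  (succ (strand (z, true)) = strand (y, false) /\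
     succ (strand (y, false)) = strand (x, true)) ->
  normalized_bracket K f =
  normalized_bracket (@swap_strands (erase [set x; z]) (exist _ y xy)) f.
Proof.
move=> Kwf K'wf xz kx kz s1 s2 s34; have [_ tI _] := Kwf.
pose X' : finType := {w : crossing K | w \notin [set x; z]}.
pose y' : X' := exist _ y xy.
have /norP[yx yz] : ~~ ((y == x) || (y == z)) by have := xy; rewrite !inE.
have othersE : perm_eq (enum X') (y' :: [seq w <- enum X' | w != y']).
  have yE : y' \in enum X' by rewrite mem_enum.
  by rewrite (permPl (perm_to_rem yE)) perm_cons rem_filter ?enum_uniq.
pose pts := [:: strand (x, true); strand (x, false); strand (y, true); strand (y, false);
  strand (z, true); strand (z, false)].
have [r succE] : exists r, all (fun ij =>
    succ (nth (strand (x, true)) pts ij.1) == nth (strand (x, true)) pts ij.2) (flank_links r).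
  by case: s34 => -[s3 s4]; [exists false | exists true]; rewrite /= s1 s2 s3 s4 !eqxx.
apply: (@diagram_move f fP K X' (fun y => kind (val y))
  (fun v => if v.1 == y' then strand (y, ~~ v.2) else strand (val v.1, v.2))
  (strand (x, true)) pts [:: x; y; z] [:: y'] [seq w <- enum X' | w != y'] val
  _ _ _ _ Kwf K'wf (virtualization_check (kind y) r)) => //.
- by rewrite /= !inE !(inj_eq tI) !xpair_eqE !andbF !andbT
    ![x == _]eq_sym (negPf yx) (negPf yz) eq_sym (negPf xz).
- rewrite -(permPr (perm_enum_erase [set x; z])).
  rewrite (permPr (perm_cat (perm_enum_set2 xz) (perm_map _ othersE))) /= perm_cons.
  exact: permEl (perm_catCA [:: y] [:: z] _).
- by rewrite perm_sym.
- move=> w; rewrite mem_filter => /andP[/negPf wy _]; split=> // j.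
  by rewrite /= wy.
- by rewrite /= /crossing_data /place /= kx kz.
- by rewrite /= /crossing_data /place /= eqxx.
Qed.
End Moves.

(** * Triangles *)

(** Distinct heights are linearly ordered, which gives the transitivity required
    of the booleans. *)
Lemma triangle_kinds_check (o : 'I_3 -> bool) e01 e02 e12 :
  triangle_kinds o e01 e02 e12 ->
  triangle_check (o line0) (o line1) (o line2) e01 e02 e12.
Proof.
case=> [[height hI [-> -> ->]]|H].
  rewrite /height_sign /first_strand; apply: classical_triangle_check.
  have ne i j : i != j -> height i != height j by move=> ij; rewrite (inj_eq hI).
  have h01 : height line0 != height line1 by apply: ne; rewrite -val_eqE /= !inordK.
  have h02 : height line0 != height line2 by apply: ne; rewrite -val_eqE /= !inordK.
  have h12 : height line1 != height line2 by apply: ne; rewrite -val_eqE /= !inordK.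
  lia.
have v e := and3P (virtual_triangle_check (o line0) (o line1) (o line2) e).
by case: H => [[-> ->]|[[-> ->]|[-> ->]]]; [case: (v e12) | case: (v e02) | case: (v e01)].
Qed.

(** The three disjoint transpositions that exchange the two crossings met by
    each line of a triangle. *)
Lemma tperm3E (T : finType) (a b c d e g : T) :
  uniq [:: a; b; c; d; e; g] ->
  let s t := tperm a c (tperm b e (tperm d g t)) in
  [/\ [/\ s a = c, s b = e & s c = a], [/\ s d = g, s e = b & s g = d] &
      forall t, t \notin [:: a; b; c; d; e; g] -> s t = t].
Proof.
move=> u s; have ne x y : x != y -> (x == y = false) * (y == x = false).
  by move=> xy; rewrite [y == x]eq_sym (negPf xy).
move: u; rewrite /= !inE !negb_or -!andbA.
do 14![case/andP => /ne ?]; move=> /andP[/ne ? _].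
have tE x y z : tperm x y z = if z == x then y else if z == y then x else z.
  by rewrite permE.
have out t : t \notin [:: a; b; c; d; e; g] -> s t = t.
  rewrite !inE !negb_or => /and5P[ta tb tc td /andP[te tg]].
  by rewrite /s (tpermD (z := t)) ?(tpermD (z := t)) // eq_sym.
split=> //; split; rewrite /s !tE;
  repeat (rewrite /= ?eqxx; match goal with H : (_ * _)%type |- _ => rewrite !H end);
  by rewrite /= ?eqxx.
Qed.

Section Triangle.
Variables (f : digraph -> graph_poly) (fP : graph_evaluation f).

Lemma triangle_invariance (K : diagram) (x01 x02 x12 : crossing K) (o : 'I_3 -> bool) :
  uniq [:: x01; x02; x12] ->
  triangle_kinds o (kind x01) (kind x02) (kind x12) ->
  let p01 := strand (x01, first_strand o line0 line1) in
  let p10 := strand (x01, ~~ first_strand o line0 line1) in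
  let p02 := strand (x02, first_strand o line0 line2) in
  let p20 := strand (x02, ~~ first_strand o line0 line2) in
  let p12 := strand (x12, first_strand o line1 line2) in
  let p21 := strand (x12, ~~ first_strand o line1 line2) in
  let K' := restrand (fun v =>
      tperm p01 p02 (tperm p10 p12 (tperm p20 p21 (strand v)))) in
  follows (o line0) p01 p02 -> follows (o line1) p10 p12 -> follows (o line2) p20 p21 ->
  well_formed K -> well_formed K' ->
  normalized_bracket K f = normalized_bracket K' f.
Proof.
move=> ux kx p01 p10 p02 p20 p12 p21 K' f0 f1 f2 Kwf K'wf; have [_ tI _] := Kwf.
have chk := triangle_kinds_check kx.
set D := [:: x01; x02; x12] in ux.
pose R := [seq x <- enum (crossing K) | x \notin D].
have DE : perm_eq (D ++ R) (enum (crossing K)).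
  by rewrite perm_sym; apply: perm_cat_subset (enum_uniq _) _ => // x _; rewrite mem_enum.
pose pts := [:: p01; p10; p02; p20; p12; p21].
have upts : uniq pts.
  have -> : pts = map (@strand K) [:: (x01, first_strand o line0 line1);
    (x01, ~~ first_strand o line0 line1); (x02, first_strand o line0 line2);
    (x02, ~~ first_strand o line0 line2); (x12, first_strand o line1 line2);
    (x12, ~~ first_strand o line1 line2)] by [].
  rewrite map_inj_uniq //=; move: ux; rewrite /D /= !inE !xpair_eqE !negb_or.
  case/andP=> /andP[/negPf -> /negPf ->] /andP[/negPf -> _] /=.
  by rewrite !eqxx; do 3 case: (first_strand _ _ _).
have [[s01 s10 s02] [s20 s12 s21] sout] := tperm3E upts.
pose s t := tperm p01 p02 (tperm p10 p12 (tperm p20 p21 t)).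
have sidesE (x : crossing K) b (T : Type) (g : point K -> T) :
    (g (strand (x, true)), g (strand (x, false))) =
    if b then (g (strand (x, b)), g (strand (x, ~~ b)))
    else (g (strand (x, ~~ b)), g (strand (x, b))) by case: b.
have RD x j : x \in R -> strand (x, j) \notin pts.
  rewrite mem_filter => /andP[xD _]; move: xD.
  rewrite /D /pts /p01 /p10 /p02 /p20 /p12 /p21 !inE !(inj_eq tI) !xpair_eqE.
  by case: (x == x01); case: (x == x02); case: (x == x12).
apply: (@diagram_move f fP K (crossing K) (@kind K) (fun v => s (strand v))
  p01 pts D D R id _ _ _ _ Kwf K'wf chk upts) => //.
- by rewrite map_id.
- by move=> x xR; split=> // j; rewrite /s sout // RD.
- rewrite /= /crossing_data /place /=.
  rewrite (sidesE x01 (first_strand o line0 line1) _ id).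
  rewrite (sidesE x02 (first_strand o line0 line2) _ id).
  rewrite (sidesE x12 (first_strand o line1 line2) _ id).
  rewrite /pts /p01 /p10 /p02 /p20 /p12 /p21 /first_strand.
  by case: (o line0 (+) o line1); case: (o line0 (+) o line2); case: (o line1 (+) o line2).
- rewrite /= /crossing_data /place /=.
  rewrite (sidesE x01 (first_strand o line0 line1) _ s).
  rewrite (sidesE x02 (first_strand o line0 line2) _ s).
  rewrite (sidesE x12 (first_strand o line1 line2) _ s).
  rewrite -/p01 -/p10 -/p02 -/p20 -/p12 -/p21 /s s01 s10 s02 s20 s12 s21.
  rewrite /pts /p01 /p10 /p02 /p20 /p12 /p21 /first_strand.
  by case: (o line0 (+) o line1); case: (o line0 (+) o line2); case: (o line1 (+) o line2).
- move: f0 f1 f2; rewrite /link.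
  by case: (o line0); case: (o line1); case: (o line2) => /= -> -> ->; rewrite !eqxx.
Qed.
End Triangle.

Theorem theorem3p1 (f : digraph -> graph_poly) (K K' : virtual_link_diagram) :
  graph_evaluation f ->
  move_equivalent K K' ->
  normalized_bracket K f = normalized_bracket K' f.
Proof.
move=> fP; elim=> [{}K {}K' move_KK'|//|{}K {}K' _ -> //|K1 K2 K3 _ -> _ -> //].
case: K K' move_KK' => [K Kwf] [K' K'wf] /= [] m.
- case: m Kwf K'wf => [L L' h g hB gB hs gk gt|L p] Lwf L'wf.
    exact: isotopy_invariance hB gB hs gk gt.
  exact: add_point_invariance.
- case: m Kwf K'wf => [L x i xi|L x y r r' xy kxy fr fr'|
    L x01 x02 x12 o ux kx p01 p10 p02 p20 p12 p21 f0 f1 f2] Lwf L'wf.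
  + exact: kink_invariance xi.
  + exact: bigon_invariance fr fr'.
  + exact: triangle_invariance f0 f1 f2 Lwf L'wf.
case: m Kwf K'wf => L x y z xy xz kx kz ky s1 s2 s34 Lwf L'wf.
exact: virtualization_invariance s34.
Qed.
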